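(* (1) The Baumslag–Solitar group $BS(1,-1)=\langle a,b\mid bab^{-1}=a^{-1}\rangle$ acts freely and minimally by IETs. (2) The crystallographic group $C_1=\langle a,b\mid ba^2b^{-1}=a^{-2},\ ab^2a^{-1}=b^{-2}\rangle$ acts freely and minimally by IETs. (3) The group $C_2=\langle a,b,c\mid aba^{-1}=b^{-1},\ bcb^{-1}=c^{-1}\rangle$ does not admit a faithful minimal action by IETs.
   Context: An interval exchange transformation (IET) is a bijection of $[0,1)$ defined by a finite partition of $[0,1)$ into half-open subintervals and a reordering of these intervals by translations; $\mathcal G$ is the group of all IETs. An action of a group $G$ by IETs is a morphism $\rho:G\to\mathcal G$. It is faithful if $\rho$ is injective; free if the only element $g\in G$ such that $\rho(g)$ has a fixed point in $[0,1)$ is the trivial element; minimal if every orbit $\rho(G)x$, $x\in[0,1)$, is dense in $[0,1)$. *)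

(* Defs.v *)
From HB Require Import structures.
From mathcomp Require Import all_boot all_order all_algebra.
From mathcomp Require Import lra.
From mathcomp Require Import all_classical all_reals all_analysis.
Set Implicit Arguments.
Unset Strict Implicit.
Unset Printing Implicit Defensive.
Import Order.TTheory GRing.Theory Num.Theory.
Import numFieldNormedType.Exports.

Section Presentation.
Variable n : nat.

(* A letter (i, false) stands for the i-th generator, (i, true) for its inverse. *)
Definition word := seq ('I_n * bool).

Definition wgen (i : 'I_n) : word := [:: (i, false)].

Definition wflip (l : 'I_n * bool) := (l.1, ~~ l.2).

Definition winv (u : word) : word := rev (map wflip u).

(* The least congruence on words that contains the relations u = v for (u, v)
   in rels and the free cancellations. *)
Inductive pres_eq (rels : seq (word * word)) : word -> word -> Prop :=
| pres_refl u : pres_eq rels u u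
| pres_sym u v : pres_eq rels u v -> pres_eq rels v u
| pres_trans u v w : pres_eq rels u v -> pres_eq rels v w -> pres_eq rels u w
| pres_cat u u' v v' :
    pres_eq rels u u' -> pres_eq rels v v' -> pres_eq rels (u ++ v) (u' ++ v')
| pres_cancel l : pres_eq rels [:: l; wflip l] [::]
| pres_rel u v : (u, v) \in rels -> pres_eq rels u v.

Variable rels : seq (word * word).

Definition pres_eqb (u v : word) : bool := `[< pres_eq rels u v >].

Lemma pres_eqb_equiv : equiv_class_of pres_eqb.
Proof.
split=> [u | u v | v u w].
- exact/asboolP/pres_refl.
- by apply/asboolP/asboolP => /pres_sym.
- by move=> /asboolP uv /asboolP vw; apply/asboolP/(pres_trans uv vw).
Qed.

Canonical pres_equiv := EquivRelPack pres_eqb_equiv.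

Definition presented := {eq_quot pres_eqb}%qT.

HB.instance Definition _ := Choice.on presented.

Definition pres_class (u : word) : presented := (\pi_presented u)%qT.

Lemma pres_classP u v : pres_class u = pres_class v <-> pres_eq rels u v.
Proof. by split=> [/eqmodP/asboolP | /asboolP uv]; [|apply/eqmodP]. Qed.

Lemma pres_class_repr x : pres_class (repr x) = x.
Proof. exact: reprK. Qed.

Lemma pres_repr u : pres_eq rels (repr (pres_class u)) u.
Proof. by apply/pres_classP; rewrite pres_class_repr. Qed.

Definition pres_mul (x y : presented) := pres_class (repr x ++ repr y).
Definition pres_one := pres_class [::].
Definition pres_inv (x : presented) := pres_class (winv (repr x)).

Lemma pres_mulE u v :
  pres_mul (pres_class u) (pres_class v) = pres_class (u ++ v).
Proof. by apply/pres_classP/pres_cat; exact: pres_repr. Qed.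

Lemma pres_mulA : associative pres_mul.
Proof.
move=> x y z; rewrite -(pres_class_repr x) -(pres_class_repr y).
by rewrite -(pres_class_repr z) !pres_mulE catA.
Qed.

Lemma pres_mul1 : left_id pres_one pres_mul.
Proof. by move=> x; rewrite -(pres_class_repr x) pres_mulE. Qed.

Lemma pres_1mul : right_id pres_one pres_mul.
Proof. by move=> x; rewrite -(pres_class_repr x) pres_mulE cats0. Qed.

Lemma wflipK : involutive wflip.
Proof. by case=> i b; rewrite /wflip /= negbK. Qed.

Lemma winvK : involutive winv.
Proof. by move=> u; rewrite /winv map_rev revK (mapK wflipK). Qed.

Lemma pres_cat_winv u : pres_eq rels (u ++ winv u) [::].
Proof.
elim: u => [|l u IHu]; first exact: pres_refl.
have -> : (l :: u) ++ winv (l :: u) = [:: l] ++ ((u ++ winv u) ++ [:: wflip l]).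
  by rewrite /winv /= rev_cons -cats1 catA.
apply: pres_trans (pres_cancel rels l).
apply: (pres_cat (pres_refl _ [:: l])).
exact: (pres_cat IHu (pres_refl _ [:: wflip l])).
Qed.

Lemma pres_mulV : right_inverse pres_one pres_inv pres_mul.
Proof.
move=> x; rewrite -{1}(pres_class_repr x) pres_mulE.
exact/pres_classP/pres_cat_winv.
Qed.

Lemma pres_Vmul : left_inverse pres_one pres_inv pres_mul.
Proof.
move=> x; rewrite -{2}(pres_class_repr x) pres_mulE.
by apply/pres_classP; rewrite -{2}(winvK (repr x)); exact: pres_cat_winv.
Qed.

HB.instance Definition _ := isGroup.Build presented
  pres_mulA pres_mul1 pres_1mul pres_Vmul pres_mulV.

End Presentation.

(* BS(1,-1) = < a, b | b a b^-1 = a^-1 > *)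
Definition BS1m1 : groupType :=
  let a := wgen (@Ordinal 2 0 isT) in
  let b := wgen (@Ordinal 2 1 isT) in
  presented [:: (b ++ a ++ winv b, winv a)].

(* C1 = < a, b | b a^2 b^-1 = a^-2, a b^2 a^-1 = b^-2 > *)
Definition C1 : groupType :=
  let a := wgen (@Ordinal 2 0 isT) in
  let b := wgen (@Ordinal 2 1 isT) in
  presented [:: (b ++ a ++ a ++ winv b, winv (a ++ a));
                (a ++ b ++ b ++ winv a, winv (b ++ b))].

(* C2 = < a, b, c | a b a^-1 = b^-1, b c b^-1 = c^-1 > *)
Definition C2 : groupType :=
  let a := wgen (@Ordinal 3 0 isT) in
  let b := wgen (@Ordinal 3 1 isT) in
  let c := wgen (@Ordinal 3 2 isT) in
  presented [:: (a ++ b ++ winv a, winv b); (b ++ c ++ winv b, winv c)].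

Local Open Scope ring_scope.

Definition unit_co (R : realType) := {x : R | 0 <= x < 1}.

(* The pieces are [(0 :: s)`_i, (0 :: s)`_i.+1) for i < size s, where
   0 = s_0 < s_1 < ... < s_k = 1 are the endpoints. *)
Definition piecewise_translation (R : realType) (f : unit_co R -> unit_co R) :=
  exists s : seq R, [/\ path <%R 0 s, last 0 s = 1 &
    forall i, (i < size s)%N -> exists t : R, forall x : unit_co R,
      (0 :: s)`_i <= val x < (0 :: s)`_i.+1 -> val (f x) = val x + t].

Record iet (R : realType) := Iet {
  iet_fun :> unit_co R -> unit_co R;
  iet_bij : bijective iet_fun;
  iet_pw : piecewise_translation iet_fun
}.

Section IetGroup.
Variable R : realType.
Implicit Types (f g : unit_co R -> unit_co R) (x y : unit_co R) (B : seq R).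

Definition rigid f B := forall x y, val x <= val y ->
  (forall b, b \in B -> val x < b -> val y < b) ->
  val (f y) = val (f x) + (val y - val x).

Lemma unit_coP (r : R) : 0 <= r -> r < 1 -> {x : unit_co R | val x = r}.
Proof.
move=> r0 r1; have rP : 0 <= r < 1 by rewrite r0.
by exists (exist _ r rP).
Qed.

Lemma next_break B (u : R) : u < 1 -> exists e, [/\ u < e, e <= 1,
  (e = 1 \/ e \in B) & forall b, b \in B -> u < b -> e <= b].
Proof.
move=> u1; elim: B => [|b B [e [ue e1 eB eP]]].
  by exists 1; split=> //; left.
have [ub|bu] := ltP u b; last first.
  exists e; split=> //; first by case: eB => [|eB]; [left|right; rewrite inE eB orbT].
  by move=> c; rewrite inE => /predU1P[->|/eP//]; rewrite ltNge bu.
have [be|eb] := ltP b e.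
  exists b; split=> //; first exact: ltW (lt_le_trans be e1).
    by right; rewrite mem_head.
  move=> c; rewrite inE => /predU1P[->//|cB uc].
  exact: ltW (lt_le_trans be (eP c cB uc)).
exists e; split=> //; first by case: eB => [|eB]; [left|right; rewrite inE eB orbT].
by move=> c; rewrite inE => /predU1P[->//|cB uc]; exact: eP.
Qed.

Lemma prev_break B (v : R) : 0 < v -> exists e, [/\ 0 <= e, e < v &
  forall b, b \in B -> e < b -> v <= b].
Proof.
move=> v0; elim: B => [|b B [e [e0 ev eP]]]; first by exists 0.
have [vb|bv] := leP v b.
  by exists e; split=> // c; rewrite inE => /predU1P[->//|cB]; exact: eP.
have [be|eb] := leP b e.
  exists e; split=> // c; rewrite inE => /predU1P[->|cB]; last exact: eP.
  by rewrite ltNge be.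
exists b; split=> //; first exact: ltW (le_lt_trans e0 eb).
move=> c; rewrite inE => /predU1P[->|cB bc]; first by rewrite ltxx.
exact: eP (lt_trans eb bc).
Qed.

Lemma path_locate (s : seq R) (a r : R) : a <= r < last a s ->
  exists2 i, (i < size s)%N & (a :: s)`_i <= r < (a :: s)`_i.+1.
Proof.
elim: s a => [|b s IHs] a /=; first by case/andP=> /le_lt_trans h /h; rewrite ltxx.
case/andP=> ar rl; have [rb|br] := ltP r b; first by exists 0%N; rewrite //= ar.
by have [|i ilt iP] := IHs b; [rewrite br|exists i.+1].
Qed.

Lemma pw_rigid f : piecewise_translation f -> exists B, rigid f B.
Proof.
case=> s [ps ls sP]; exists s => x y xy nb.
have [x0 x1] := andP (valP x).
have [|i ilt /andP[ix xi]] := @path_locate s 0 (val x).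
  by rewrite ls x0 x1.
have [t tP] := sP i ilt.
have yi : val y < (0 :: s)`_i.+1 by apply: nb => //=; exact: mem_nth.
rewrite (tP y) ?(tP x) ?ix //; first by lra.
by rewrite (le_trans ix xy).
Qed.

Lemma rigid_pw f B : rigid f B -> piecewise_translation f.
Proof.
move=> fB; pose B1 := sort <=%R (undup (1 :: [seq b <- B | 0 < b < 1])).
have memB1 r : (r \in B1) = (r == 1) || (0 < r < 1) && (r \in B).
  by rewrite mem_sort mem_undup inE mem_filter.
have pB : path <%R 0 B1.
  rewrite lt_path_sortedE; apply/andP; split.
    apply/allP=> r; rewrite memB1.
    by case/predU1P=> [->|/andP[/andP[]]]; rewrite ?ltr01.
  by rewrite lt_sorted_uniq_le sort_uniq undup_uniq sort_le_sorted.
have srt : sorted <%R (0 :: B1) by [].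
have mono : forall j k, (j <= k)%N -> (k <= size B1)%N ->
    (0 :: B1)`_j <= (0 :: B1)`_k.
  move=> j k jk ks; rewrite (lt_sorted_leq_nth 0 srt) // inE /= ltnS //.
  exact: leq_trans jk ks.
have lB : last 0 B1 = 1.
  have B1n : 1 \in B1 by rewrite memB1 eqxx.
  apply/eqP; rewrite eq_le; apply/andP; split.
    have : last 0 B1 \in 0 :: B1 by exact: mem_last.
    rewrite inE memB1 => /predU1P[->|]; first exact: ler01.
    by case/predU1P=> [->//|/andP[/andP[_ /ltW]]].
  have /(nthP 0)[i ilt <-] : 1 \in 0 :: B1 by rewrite inE B1n orbT.
  by rewrite (last_nth 0); exact: mono.
exists B1; split=> // i ilt.
have a0 : 0 <= (0 :: B1)`_i by exact: (mono 0%N i _ (ltnW ilt)).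
have ai : (0 :: B1)`_i < (0 :: B1)`_i.+1.
  by rewrite (lt_sorted_ltn_nth 0 srt) // inE /= ltnS // ltnW.
have i1 : (0 :: B1)`_i.+1 <= 1.
  rewrite -lB (last_nth 0); exact: mono.
have [a aE] := unit_coP a0 (lt_le_trans ai i1).
exists (val (f a) - val a) => x /andP[ax xi].
rewrite (fB a x) ?aE //; last first.
  move=> b bB ab; rewrite ltNge; apply/negP => bx.
  have bin : b \in B1.
    rewrite memB1 bB (le_lt_trans a0 ab) (le_lt_trans bx (lt_le_trans xi i1)).
    by rewrite orbT.
  have /(nthP 0)[j jlt jb] : b \in 0 :: B1 by rewrite inE bin orbT.
  have [ji|ij] := leqP j i.
    by have := mono j i ji (ltnW ilt); rewrite jb leNgt ab.
  by have := mono _ _ ij jlt; rewrite jb leNgt (le_lt_trans bx xi).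
by rewrite addrCA.
Qed.

Lemma rigid_comp f g Bf Bg : bijective f -> rigid f Bf -> rigid g Bg ->
  exists B, rigid (g \o f) B.
Proof.
case=> h fK hK fB gB.
pose F := fun b : R => if insub b is Some y then val (h y) else b.
exists (Bf ++ [seq F b | b <- Bg]) => x y xy nb.
change (val (g (f y)) = val (g (f x)) + (val y - val x)).
have nbf : forall z : unit_co R, val z <= val y -> forall b, b \in Bf -> val x < b -> val z < b.
  move=> z zy b bB xb; apply: (le_lt_trans zy).
  by apply: nb => //; rewrite mem_cat bB.
have fyE := fB x y xy (nbf y (lexx _)).
rewrite (gB (f x) (f y)) ?fyE ?lerDl ?subr_ge0 //.
  by lra.
move=> b bB xb; rewrite ltNge; apply/negP => by_.
pose r := val x + (b - val (f x)).
have xr : val x < r by rewrite ltrDl subr_gt0.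
have ry : r <= val y.
  by rewrite /r -lerBrDl lerBlDl.
have [x0 x1] := andP (valP x); have [y0 y1] := andP (valP y).
have [z zE] := unit_coP (ltW (le_lt_trans x0 xr)) (le_lt_trans ry y1).
have fz : val (f z) = b.
  rewrite (fB x z) ?zE ?(ltW xr) //; last by rewrite -zE; apply: nbf; rewrite zE.
  by rewrite /r; lra.
have Fb : F b = val z by rewrite /F -fz valK fK.
suff : val y < val z by rewrite zE ltNge ry.
apply: nb; rewrite ?zE // -zE -Fb mem_cat; apply/orP; right; exact: map_f.
Qed.

Lemma rigid_inv f h B : cancel f h -> cancel h f -> rigid f B ->
  exists B', rigid h B'.
Proof.
move=> fK hK fB.
pose F := fun b : R => if insub b is Some y then val (f y) else b.
exists [seq F b | b <- 0 :: B] => x y xy nb.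
have [x0 x1] := andP (valP x); have [y0 y1] := andP (valP y).
have [u0 u1] := andP (valP (h x)).
have [e [ue e1 eB eP]] := next_break B u1.
have step : forall z : unit_co R, val (h x) <= val z -> val z < e ->
    val (f z) = val x + (val z - val (h x)).
  move=> z uz ze; rewrite (fB (h x) z) ?hK // => b bB ub.
  exact: lt_le_trans ze (eP b bB ub).
have [ye|ey] := ltP (val (h x) + (val y - val x)) e.
  have uy : val (h x) <= val (h x) + (val y - val x) by rewrite lerDl subr_ge0.
  have [z zE] := unit_coP (le_trans u0 uy) (lt_le_trans ye e1).
  have fz : f z = y.
    apply: val_inj; rewrite step ?zE //.
    by lra.
  by rewrite -fz fK zE fz.
exfalso; pose w := val x + (e - val (h x)).
have xw : val x < w by rewrite ltrDl subr_gt0.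
have wy : w <= val y by rewrite /w -lerBrDl lerBlDl.
have [w' wE] := unit_coP (ltW (le_lt_trans x0 xw)) (le_lt_trans wy y1).
suff vB : val (h w') \in 0 :: B.
  suff : val y < val w' by rewrite wE ltNge wy.
  have Fv : F (val (h w')) = val w' by rewrite /F valK hK.
  by apply: nb; rewrite ?wE // -wE -Fv; exact: map_f.
rewrite inE; apply/orP; have [v0|vn0] := eqVneq (val (h w')) 0; [by left|right].
have [v0 v1] := andP (valP (h w')).
have vgt0 : 0 < val (h w') by rewrite lt_def vn0.
have [p [p0 pv pP]] := prev_break B vgt0.
case: (boolP (val (h w') \in B)) => // vB; exfalso.
pose d := Num.min (val (h w') - p) (e - val (h x)) / 2%:R.
have d0 : 0 < d by rewrite divr_gt0 ?ltr0n // lt_min !subr_gt0 pv ue.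
have dd : d < d + d by rewrite ltrDl.
have d2 : d + d = Num.min (val (h w') - p) (e - val (h x)).
  by rewrite -splitr.
have dv : d < val (h w') - p.
  by apply: lt_le_trans dd _; rewrite d2 ge_min lexx.
have de : d < e - val (h x).
  by apply: lt_le_trans dd _; rewrite d2 ge_min lexx orbT.
have pvd : p < val (h w') - d by rewrite ltrBrDl -ltrBrDr.
have ued : val (h x) < e - d by rewrite ltrBrDl -ltrBrDr.
have zl1 : val (h w') - d < 1 by rewrite ltrBlDr (lt_trans v1) // ltrDl.
have ed1 : e - d < 1 by rewrite ltrBlDr (le_lt_trans e1) // ltrDl.
have [z1 z1E] := unit_coP (ltW (le_lt_trans p0 pvd)) zl1.
have [z2 z2E] := unit_coP (ltW (le_lt_trans u0 ued)) ed1.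
have f2 : val (f z2) = w - d.
  rewrite step ?z2E ?ltW // ?ltrBlDr ?ltrDl // /w.
  by lra.
have f1 : val w' = val (f z1) + d.
  rewrite -{1}(hK w') (fB z1 (h w')) ?z1E.
  - by lra.
  - by rewrite lerBlDr lerDl ltW.
  move=> b bB zb; rewrite lt_def pP ?andbT ?(lt_trans pvd) //.
  by apply: contraNneq vB => <-.
have z12 : z1 = z2.
  apply: (can_inj fK); apply: val_inj; rewrite f2 -wE f1 addrK //.
have ve : val (h w') = e.
  by apply: (addIr (- d)); rewrite -z1E -z2E z12.
case: eB => [eE|eB]; first by move: v1; rewrite ve eE ltxx.
by move: vB; rewrite ve eB.
Qed.

Lemma iet_eq (f g : iet R) : (forall x, f x = g x) -> f = g.
Proof.
case: f g => f bf pf [g bg pg] /= /funext fg.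
by case: _ / fg in bg pg *; congr Iet; exact: Prop_irrelevance.
Qed.

HB.instance Definition _ := gen_eqMixin (iet R).
HB.instance Definition _ := gen_choiceMixin (iet R).

Lemma iet_one_pw : piecewise_translation (@id (unit_co R)).
Proof. by apply: (@rigid_pw _ [::]) => x y _ _; rewrite addrC subrK. Qed.

Definition iet_one := Iet (Bijective (frefl _) (frefl _)) iet_one_pw.

Lemma iet_mul_pw (f g : iet R) : piecewise_translation (f \o g).
Proof.
have [Bf fB] := pw_rigid (iet_pw f); have [Bg gB] := pw_rigid (iet_pw g).
by have [B] := rigid_comp (iet_bij g) gB fB; exact: rigid_pw.
Qed.

Definition iet_mul (f g : iet R) :=
  Iet (bij_comp (iet_bij f) (iet_bij g)) (iet_mul_pw f g).

Lemma iet_inv_subproof (f : iet R) : exists h, cancel f h /\ cancel h f.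
Proof. by case: (iet_bij f) => h fK hK; exists h. Qed.

Definition iet_inv_fun (f : iet R) := projT1 (cid (iet_inv_subproof f)).

Lemma iet_funK (f : iet R) : cancel f (iet_inv_fun f).
Proof. by case: (projT2 (cid (iet_inv_subproof f))). Qed.

Lemma iet_inv_funK (f : iet R) : cancel (iet_inv_fun f) f.
Proof. by case: (projT2 (cid (iet_inv_subproof f))). Qed.

Lemma iet_inv_pw (f : iet R) : piecewise_translation (iet_inv_fun f).
Proof.
have [B fB] := pw_rigid (iet_pw f).
by have [B'] := rigid_inv (@iet_funK f) (@iet_inv_funK f) fB; exact: rigid_pw.
Qed.

Definition iet_inv (f : iet R) :=
  Iet (Bijective (@iet_inv_funK f) (@iet_funK f)) (iet_inv_pw f).

Lemma iet_mulA : associative iet_mul.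
Proof. by move=> f g h; exact: iet_eq. Qed.

Lemma iet_mul1 : left_id iet_one iet_mul.
Proof. by move=> f; exact: iet_eq. Qed.

Lemma iet_1mul : right_id iet_one iet_mul.
Proof. by move=> f; exact: iet_eq. Qed.

Lemma iet_Vmul : left_inverse iet_one iet_inv iet_mul.
Proof. by move=> f; apply: iet_eq => x; exact: iet_funK. Qed.

Lemma iet_mulV : right_inverse iet_one iet_inv iet_mul.
Proof. by move=> f; apply: iet_eq => x; exact: iet_inv_funK. Qed.

(* The product is composition: (f * g) x = f (g x). *)
HB.instance Definition _ := isGroup.Build (iet R)
  iet_mulA iet_mul1 iet_1mul iet_Vmul iet_mulV.

End IetGroup.

Section Actions.
Variables (R : realType) (G : groupType).
Implicit Type rho : {multiplicative G -> iet R}.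

Definition faithful_action rho := injective rho.

Definition free_action rho :=
  forall g : G, (exists x, rho g x = x) -> g = 1%g.

Definition orbit rho (x : unit_co R) : set R :=
  [set val (rho g x) | g in [set: G]]%classic.

Definition minimal_action rho :=
  forall x, (`[0, 1[ `<=` closure (orbit rho x))%classic.

End Actions.

(* Main.v *)
(* BS(1,-1) and C_1 contain a normal subgroup Z^2, resp. Z^3, which acts on the
   circle freely by rotations with rationally independent angles. The induced
   action on the disjoint union of one circle per coset is minimal, and free
   because an element outside the subgroup fixes no coset.

   In C_2 the infinite cyclic group generated by b^2 is normal, so for a faithful
   minimal action f = rho(b^2) has no periodic point. Two germs, to the right of a
   point and to the left of a point, are glued when f^n eventually carries them to
   a common point; this can be done for n -> +oo and for n -> -oo. If the two
   gluings differ, they differ along finitely many f-orbits, and C_2 permutes these.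
   If they agree, gluing [0, 1) accordingly yields finitely many circles on which C_2
   acts by isometries, hence commuting with their rotation flow. In both cases
   elements of the centralizer of f have powers that act on each of finitely many
   orbits through a commutative monoid, hence commute: so (a^2)^N and c^N
   commute for some N > 0, which is false in C_2. *)
Require Import Defs.
From HB Require Import structures.
From mathcomp Require Import all_boot all_order all_algebra.
From mathcomp Require Import zify ring lra.
From mathcomp Require Import all_classical all_reals all_analysis.
Set Implicit Arguments.
Unset Strict Implicit.
Unset Printing Implicit Defensive.
Import Order.TTheory GRing.Theory Num.Theory.
Import numFieldNormedType.Exports.

(** * Maps out of a presented group *)

Section WordActions.
Variables (n : nat) (rels : seq (word n * word n)).

Definition word_act (T : Type) (act : 'I_n * bool -> T -> T) (u : word n) x :=
  foldr act x u.

Lemma word_act_cat T act u v (x : T) :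
  word_act act (u ++ v) x = word_act act u (word_act act v x).
Proof. by rewrite /word_act foldr_cat. Qed.

(** Induction on the derivation, [pres_eq] being the least congruence. One cancellation per letter
    suffices, since [l] also ranges over the flipped letters. *)
Lemma pres_eq_act T (act : 'I_n * bool -> T -> T) u v :
    (forall l, cancel (act (wflip l)) (act l)) ->
    (forall r, r \in rels -> word_act act r.1 =1 word_act act r.2) ->
  pres_eq rels u v -> word_act act u =1 word_act act v.
Proof.
move=> actK relsP; elim=> {u v}.
- by [].
- by move=> u v _ uv x; rewrite uv.
- by move=> u v w _ uv _ vw x; rewrite uv vw.
- by move=> u u' v v' _ uE _ vE x; rewrite !word_act_cat uE vE.
- by move=> l x; exact: actK.
- by move=> u v uv; exact: relsP uv.
Qed.

Local Open Scope group_scope.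

(** [T] carries no group structure, so explicit actions on numbers can later separate elements of a
    presented group. *)
Lemma presented_act T (act : 'I_n * bool -> T -> T) :
    (forall l, cancel (act (wflip l)) (act l)) ->
    (forall r, r \in rels -> word_act act r.1 =1 word_act act r.2) ->
  exists A : presented rels -> T -> T,
    (forall u, A (pres_class rels u) =1 word_act act u) /\
    (forall x y t, A (x * y) t = A x (A y t)).
Proof.
move=> actK relsP; exists (fun x => word_act act (repr x)).
have AE u : word_act act (repr (pres_class rels u)) =1 word_act act u.
  by apply: (pres_eq_act actK relsP); exact: pres_repr.
split=> // x y t; rewrite -(pres_class_repr x) -(pres_class_repr y).
by rewrite [_ * _]pres_mulE !AE word_act_cat.
Qed.

Definition gen_act (H : groupType) (gen : 'I_n -> H) (l : 'I_n * bool) (x : H) :=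
  (if l.2 then (gen l.1)^-1 else gen l.1) * x.

Definition word_eval (H : groupType) (gen : 'I_n -> H) u :=
  word_act (gen_act gen) u 1.

Lemma word_act_eval (H : groupType) (gen : 'I_n -> H) u x :
  word_act (gen_act gen) u x = word_eval gen u * x.
Proof.
rewrite /word_eval; elim: u => [|l u IHu] /=; first by rewrite mul1g.
by rewrite IHu /gen_act mulgA.
Qed.

(** Von Dyck's theorem: words act on [H] by left multiplication, and the morphism evaluates this
    action at 1. *)
Lemma presented_lift (H : groupType) (gen : 'I_n -> H) :
    (forall r, r \in rels -> word_eval gen r.1 = word_eval gen r.2) ->
  exists rho : {multiplicative presented rels -> H},
    forall u, rho (pres_class rels u) = word_eval gen u.
Proof.
move=> relsP.
have [||A [AE AM]] := @presented_act H (gen_act gen).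
- by case=> i [] x; rewrite /gen_act /= ?mulKg ?mulVKg.
- by move=> r rP x; rewrite !word_act_eval relsP.
pose rho x := A x 1.
have rhoM : {morph rho : x y / x * y}.
  move=> x y; rewrite /rho AM -(pres_class_repr x) -(pres_class_repr y).
  by rewrite !AE word_act_eval.
pose m := isMultiplicative.Build _ _ rho rhoM.
pose phi : {multiplicative presented rels -> H} := HB.pack rho m.
by exists phi => u; exact: AE.
Qed.

Lemma pres_class_cat u v :
  pres_class rels (u ++ v) = pres_class rels u * pres_class rels v.
Proof. by rewrite [RHS]pres_mulE. Qed.

Lemma pres_class_nil : pres_class rels [::] = 1.
Proof. by []. Qed.

Lemma pres_class_winv u : pres_class rels (winv u) = (pres_class rels u)^-1.
Proof.
apply: (mulgI (pres_class rels u)); rewrite mulgV -pres_class_cat -pres_class_nil.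
exact/pres_classP/pres_cat_winv.
Qed.

Lemma pres_class_rel u v : (u, v) \in rels -> pres_class rels u = pres_class rels v.
Proof. by move=> uv; apply/pres_classP/pres_rel. Qed.

Lemma presented_ind (P : presented rels -> Prop) :
    P 1 ->
    (forall i x, P x -> P (pres_class rels (wgen i) * x)) ->
    (forall i x, P x -> P ((pres_class rels (wgen i))^-1 * x)) ->
  forall x, P x.
Proof.
move=> P1 Pg Pv x; rewrite -(pres_class_repr x).
elim: (repr x) => [//|[i b] u IHu].
rewrite -cat1s pres_class_cat; case: b; last exact: Pg.
by rewrite -[[:: _]]/(winv (wgen i)) pres_class_winv; exact: Pv.
Qed.

End WordActions.

(** * Integer powers in a group and their images under morphisms *)

Section IntegerPowers.
Local Open Scope group_scope.

Definition zpow (G : groupType) (x : G) (n : int) : G :=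
  match n with Posz k => x ^+ k | Negz k => x ^- k.+1 end.

Variable G : groupType.
Implicit Types (x y : G) (n : int).

Lemma zpowS x n : x * zpow x n = zpow x (n + 1)%R.
Proof.
case: n => k; first by rewrite /= -expgS; congr (_ ^+ _); lia.
have -> : (Negz k + 1 = - Posz k)%R by lia.
rewrite /= expgSr invgM mulVKg; case: k => [|k]; first by rewrite invg1.
by rewrite -NegzE.
Qed.

Lemma zpowV x n : zpow x^-1 n = zpow x (- n)%R.
Proof.
case: n => [[|k]|k]; first by [].
  by rewrite -NegzE /= expVgn.
by rewrite /= expVgn invgK.
Qed.

Lemma zpow_conj g x y n : g * x = y * g -> g * zpow x n = zpow y n * g.
Proof.
move=> gx.
have pos z t k : g * z = t * g -> g * z ^+ k = t ^+ k * g.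
  move=> gz; elim: k => [|k IHk]; first by rewrite !expg0 mulg1 mul1g.
  by rewrite !expgS mulgA gz -mulgA IHk mulgA.
case: n => k /=; first exact: pos.
rewrite -!expVgn; apply: pos.
by apply: (mulgI y); rewrite mulVKg mulgA -gx -mulgA mulgV mulg1.
Qed.

Lemma zpowD x m n : zpow x (m + n)%R = zpow x m * zpow x n.
Proof.
have nat k z : zpow x (Posz k + z)%R = x ^+ k * zpow x z.
  elim: k => [|k IHk]; first by rewrite expg0 mul1g add0r.
  by rewrite expgS -mulgA -IHk zpowS; congr zpow; lia.
case: m => k; first exact: nat.
by apply: (mulgI (x ^+ k.+1)); rewrite /= mulVKg -nat; congr zpow; lia.
Qed.

Lemma commute_zpow x y m n : commute x y -> commute (zpow x m) (zpow y n).
Proof.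
move=> xy; have xyn : x * zpow y n = zpow y n * x by exact: zpow_conj.
by symmetry; apply: zpow_conj.
Qed.

End IntegerPowers.

Section MultiplicativeGroupMaps.
Local Open Scope group_scope.
Variables (G H : groupType) (f : {multiplicative G -> H}).
Implicit Types (x : G) (n : nat).

Lemma gmulf_one : f 1 = 1.
Proof. by apply: (mulgI (f 1)); rewrite -gmulfM !mulg1. Qed.

Lemma gmulf_inv x : f x^-1 = (f x)^-1.
Proof. by apply: (mulgI (f x)); rewrite -gmulfM !mulgV gmulf_one. Qed.

Lemma gmulf_expg x n : f (x ^+ n) = f x ^+ n.
Proof.
elim: n => [|n IHn]; first by rewrite !expg0 gmulf_one.
by rewrite !expgS gmulfM IHn.
Qed.

Lemma gmulf_zpow x (n : int) : f (zpow x n) = zpow (f x) n.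
Proof. by case: n => k /=; rewrite ?gmulf_inv gmulf_expg. Qed.

End MultiplicativeGroupMaps.

Local Open Scope ring_scope.

(** * Interval exchanges that permute and rotate circles *)

Section Towers.
Variables (R : realType) (I : finType).
Implicit Types (i j : I) (y : R).

Definition frac_part y : R := y - (Num.floor y)%:~R.

Lemma frac_part_itv y : 0 <= frac_part y < 1.
Proof. by have := floor_itv y; rewrite /frac_part intrD; lra. Qed.

Lemma frac_part_eq y z (n : int) : z = y + n%:~R -> frac_part z = frac_part y.
Proof.
move=> ->; rewrite /frac_part floorDrz ?intrKfloor ?intr_int // intrD.
lra.
Qed.

Lemma frac_part_id y : 0 <= y < 1 -> frac_part y = y.
Proof.
move=> y01; rewrite /frac_part (@floor_def _ _ 0) ?mulr0z ?subr0 //.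
Qed.

Definition slot i y : R := ((enum_rank i)%:R + frac_part y) / #|I|%:R.

Lemma card_slot_gt0 i : (0 < #|I|%:R :> R).
Proof. by rewrite ltr0n; apply/card_gt0P; exists i. Qed.

Lemma slot_itv i y : 0 <= slot i y < 1.
Proof.
have I0 := card_slot_gt0 i; have /andP[f0 f1] := frac_part_itv y.
rewrite /slot; apply/andP; split; first by apply: divr_ge0; rewrite ?ler0n // addr_ge0 ?ler0n.
rewrite ltr_pdivrMr //.
have := ltn_ord (enum_rank i); rewrite mul1r -(ltr_nat R) => lt.
apply: (@lt_le_trans _ _ ((enum_rank i).+1%:R)); last by rewrite ler_nat.
by rewrite -natr1 ltrD2l.
Qed.

(* The point over [y mod 1] in the i-th of #|I| consecutive circles of length 1/#|I|. *)
Definition pt i y : unit_co R := exist _ (slot i y) (slot_itv i y).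

Lemma val_pt i y : val (pt i y) = ((enum_rank i)%:R + frac_part y) / #|I|%:R.
Proof. by []. Qed.

Lemma pt_eq i j y z : pt i y = pt j z <-> i = j /\ exists n : int, z = y + n%:~R.
Proof.
split=> [/(congr1 val)|[<- [n zE]]]; last first.
  by apply: val_inj; rewrite !val_pt (frac_part_eq zE).
rewrite !val_pt => /(mulIf _) E.
have {E} := E (lt0r_neq0 _); rewrite invr_gt0 => /(_ (card_slot_gt0 i)) E.
have fy := frac_part_itv y; have fz := frac_part_itv z.
have ij : i = j.
  apply: (can_inj enum_rankK); apply: val_inj => /=; apply/eqP.
  case: ltngtP => //; rewrite -(ler_nat R) -natr1; lra.
split=> //; exists (Num.floor z - Num.floor y).
by move: E; rewrite ij /frac_part intrB; lra.
Qed.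

Lemma pt_congr i j y z : i = j -> y = z -> pt i y = pt j z.
Proof. by move=> -> ->. Qed.

Hypothesis I_gt0 : (0 < #|I|)%N.

Lemma pt_surj (x : unit_co R) : exists i y, 0 <= y < 1 /\ x = pt i y.
Proof.
have I0 : 0 < #|I|%:R :> R by rewrite ltr0n.
have /andP[x0 x1] := valP x.
pose w := val x * #|I|%:R.
have w0 : 0 <= w by rewrite mulr_ge0 // ltW.
have w1 : w < #|I|%:R by rewrite /w -[ltRHS]mul1r ltr_pM2r.
have fw := floor_itv w; have fw0 : 0 <= Num.floor w by rewrite floor_ge0.
have fwE : (Num.floor w)%:~R = (absz (Num.floor w))%:R :> R.
  by rewrite -{1}(gez0_abs fw0).
have lt : (absz (Num.floor w) < #|I|)%N.
  by rewrite -(ltr_nat R) -fwE; lra.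
exists (enum_val (Ordinal lt)), (frac_part w); split; first exact: frac_part_itv.
apply: val_inj; rewrite val_pt enum_valK /=.
rewrite (frac_part_id (frac_part_itv w)) /frac_part fwE addrC subrK.
by rewrite mulfK // lt0r_neq0.
Qed.

Lemma tower_iet (s : I -> I) (th : I -> R) : injective s ->
  exists f : iet R, forall i y, f (pt i y) = pt (s i) (y + th i).
Proof.
move=> s_inj.
have I0 : 0 < #|I|%:R :> R by rewrite ltr0n.
have /choice[c cP] (x : unit_co R) : exists iy : I * R,
    0 <= iy.2 < 1 /\ x = pt iy.1 iy.2.
  by have [i [y iyP]] := pt_surj x; exists (i, y).
pose f x := pt (s (c x).1) ((c x).2 + th (c x).1).
have fE i y : f (pt i y) = pt (s i) (y + th i).
  rewrite /f; have [_ /pt_eq[<- [n ->]]] := cP (pt i y).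
  by apply/pt_eq; split=> //; exists (- n); rewrite intrN; lra.
pose s' := invF s_inj.
pose h x := pt (s' (c x).1) ((c x).2 - th (s' (c x).1)).
have hE i y : h (pt i y) = pt (s' i) (y - th (s' i)).
  rewrite /h; have [_ /pt_eq[<- [n ->]]] := cP (pt i y).
  by apply/pt_eq; split=> //; exists (- n); rewrite intrN; lra.
have f_bij : bijective f.
  exists h => x; have [i [y [_ ->]]] := pt_surj x.
    by rewrite fE hE /s' invF_f addrK.
  by rewrite hE fE /s' f_invF subrK.
(* Breaks: the left ends of the slots and, on each circle [j], the point [- th j] where the rotation
   wraps around. *)
pose B := [seq (enum_rank j)%:R / #|I|%:R | j <- enum I] ++
  [seq val (pt j (- th j)) | j <- enum I].
have fB : rigid f B.
  move=> x y xy nb.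
  have [i [u [u01 xE]]] := pt_surj x; have [j [v [v01 yE]]] := pt_surj y.
  have xE' : val x = ((enum_rank i)%:R + u) / #|I|%:R.
    by rewrite xE val_pt frac_part_id.
  have yE' : val y = ((enum_rank j)%:R + v) / #|I|%:R.
    by rewrite yE val_pt frac_part_id.
  move: xy; rewrite xE' yE' ler_pM2r ?invr_gt0 // => xy.
  have rij : enum_rank i = enum_rank j :> nat.
    apply/eqP; case: ltngtP => // ij; exfalso.
      have : val y < (enum_rank j)%:R / #|I|%:R.
        apply: nb; last first.
          rewrite xE' ltr_pM2r ?invr_gt0 //.
          by move: ij; rewrite -(ler_nat R) -natr1; lra.
        by rewrite mem_cat; apply/orP; left; apply: map_f; rewrite mem_enum.
      by rewrite yE' ltr_pM2r ?invr_gt0 //; lra.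
    by move: ij; rewrite -(ler_nat R) -natr1; lra.
  have ij : i = j by apply: (can_inj enum_rankK); apply: val_inj.
  rewrite -ij in rij yE yE' xy * => {rij ij}.
  rewrite {1}xE {1}yE !fE !val_pt.
  (* If the floor jumped to [n] between [u] and [v], the break [n - th i] would lie between them. *)
  have floorE : Num.floor (v + th i) = Num.floor (u + th i).
    set n := Num.floor _; symmetry; apply: floor_def.
    have /andP[n1 n2] := floor_itv (v + th i); rewrite -/n in n1 n2.
    apply/andP; split; last by lra.
    rewrite leNgt; apply/negP => un.
    have nE : frac_part (- th i) = n%:~R - th i.
      rewrite -(@frac_part_id (n%:~R - th i)); last by lra.
      by symmetry; apply: (@frac_part_eq _ _ n); rewrite addrC.
    have : val y < val (pt i (- th i)).
      apply: nb; last first.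
        by rewrite xE' val_pt nE ltr_pM2r ?invr_gt0 //; lra.
      by rewrite mem_cat; apply/orP; right;
         apply: (map_f (fun j => val (pt j (- th j)))); rewrite mem_enum.
    by rewrite yE' val_pt nE ltr_pM2r ?invr_gt0 //; lra.
  by rewrite /frac_part floorE; field; rewrite lt0r_neq0.
by exists (Iet f_bij (rigid_pw fB)).
Qed.

End Towers.

(** * Independent angles and density of irrational rotations *)

Section Irrational.
Variable R : realType.
Implicit Types (x y : R).

(** A countable set is Lebesgue null, whereas [[0, 1]] has measure 1. *)
Lemma exists_notin_countable (D : set R) : countable D -> exists x, ~ D x.
Proof.
move=> cD; apply/existsNP => DT.
have : lebesgue_measure D = 0%E by exact: countable_lebesgue_measure0.
have -> : D = setT by rewrite -subTset => x _; exact: DT.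
move=> T0; have : (lebesgue_measure (`[0%R, 1%R]%classic : set R) <= 0)%E.
  rewrite -T0; apply: le_measure; rewrite ?inE //; exact: measurable_itv.
by rewrite lebesgue_measure_itv /= lte_fin ltr01 oppr0 adde0 lee_fin ler10.
Qed.

Lemma exists_notin_range (T : countType) (f : T -> R) : exists x, forall t, x != f t.
Proof.
have [|x xP] := @exists_notin_countable (range f).
  apply: (@sub_countable _ _ _ [set: T]); first exact: card_image_le.
  exact: countableP.
by exists x => t; apply/eqP => xf; apply: xP; exists t.
Qed.

(** In other words 1, [a], [b], [c] are linearly independent over the rationals. Each number in turn
    avoids the countably many solutions of a relation with the earlier ones. *)
Lemma exists_independent : exists a b c : R, forall i j k n : int,
  i%:~R * a + j%:~R * b + k%:~R * c = n%:~R -> [/\ i = 0, j = 0 & k = 0].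
Proof.
have [a aP] := exists_notin_range (fun t : int * int => t.2%:~R / t.1%:~R).
have [b bP] := exists_notin_range (fun t : int * int * int =>
  (t.2%:~R - t.1.1%:~R * a) / t.1.2%:~R).
have [c cP] := exists_notin_range (fun t : int * int * int * int =>
  (t.2%:~R - t.1.1.1%:~R * a - t.1.1.2%:~R * b) / t.1.2%:~R).
have solve x y (m : int) : m != 0 -> m%:~R * x = y -> x = y / m%:~R.
  by move=> m0 <-; rewrite mulrC mulKf ?intr_eq0.
exists a, b, c => i j k n E.
have k0 : k = 0.
  apply/eqP; apply: contraT => k0; have := cP (i, j, k, n) => /=.
  by rewrite -(solve c _ _ k0) ?eqxx //; lra.
have j0 : j = 0.
  apply/eqP; apply: contraT => j0; have := bP (i, j, n) => /=.
  by rewrite -(solve b _ _ j0) ?eqxx //; move: E; rewrite k0 mulr0z; lra.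
split=> //; apply/eqP; apply: contraT => i0; have := aP (i, n) => /=.
by rewrite -(solve a _ _ i0) ?eqxx //; move: E; rewrite k0 j0 mulr0z; lra.
Qed.

Variable a : R.
Hypothesis a_irr : forall i n : int, i%:~R * a = n%:~R -> i = 0.

(** Dirichlet's pigeonhole: two of [N.+1] fractional parts of multiples of [a] share one of [N]
    boxes of length [1/N < e]. Irrationality makes their difference nonzero, and its sign can be
    changed. *)
Lemma small_rotation e : 0 < e ->
  exists i n : int, 0 < i%:~R * a + n%:~R < e.
Proof.
move=> e0.
pose N := (Num.bound e^-1); have N0 : (0 < N)%N.
  rewrite -(ltr_nat R); apply: le_lt_trans (archi_boundP _); rewrite invr_ge0 //; exact: ltW.
have Ne : N%:R^-1 < e.
  rewrite invf_plt ?posrE ?ltr0n //; apply: archi_boundP.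
  by rewrite invr_ge0 ltW.
pose r (k : 'I_N.+1) := frac_part (k%:R * a).
have r01 k : 0 <= r k < 1 := frac_part_itv _.
have fN0 k : 0 <= Num.floor (N%:R * r k).
  by rewrite floor_ge0 mulr_ge0 //; have /andP[] := r01 k.
have fNE k : (absz (Num.floor (N%:R * r k)))%:R = (Num.floor (N%:R * r k))%:~R :> R.
  by rewrite -{2}(gez0_abs (fN0 k)).
have NR : 0 < N%:R :> R by rewrite ltr0n.
have lt k : (absz (Num.floor (N%:R * r k)) < N)%N.
  rewrite -(ltr_nat R) fNE; apply: le_lt_trans (floor_le _) _.
  by have /andP[_ r1] := r01 k; rewrite -[ltRHS]mulr1 ltr_pM2l.
pose box k := Ordinal (lt k).
have /injectivePn[k [l kl bkl]] : ~~ injectiveb box.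
  by apply/negP => /injectiveP/leq_card; rewrite !card_ord ltnn.
have close : `|r k - r l| < e.
  apply: lt_trans Ne; rewrite ltr_norml -(ltr_pM2l NR) -[X in _ && X](ltr_pM2l NR).
  rewrite mulrN mulfV ?lt0r_neq0 //.
  have /(congr1 (fun m : 'I_N => (m : nat)%:R : R)) := bkl; rewrite /= !fNE.
  have := floor_itv (N%:R * r k); have := floor_itv (N%:R * r l).
  by rewrite !intrD; lra.
have [i [n [i0 E]]] : exists i n : int, i != 0 /\ r k - r l = i%:~R * a + n%:~R.
  exists (Posz k - Posz l), (Num.floor (l%:R * a) - Num.floor (k%:R * a)).
  split; last by rewrite /r /frac_part !intrB -!pmulrn; lra.
  by rewrite subr_eq0; apply: contra_neq kl => -[kl]; exact: val_inj.
rewrite E in close.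
have nz : i%:~R * a + n%:~R != 0.
  apply: contra_neq i0 => /eqP; rewrite addr_eq0 -intrN => /eqP; exact: a_irr.
have [p|p] := ltP 0 (i%:~R * a + n%:~R).
  by exists i, n; rewrite p /=; move: close; rewrite gtr0_norm.
exists (- i), (- n); have {}p : i%:~R * a + n%:~R < 0 by rewrite lt_def eq_sym nz.
by move: close; rewrite ltr0_norm // !intrN; lra.
Qed.

(** The multiples of a small rotation [d < e] divide the line into steps shorter than [e]. *)
Lemma rotation_dense x e : 0 < e -> exists i n : int, `|i%:~R * a + n%:~R - x| < e.
Proof.
move=> e0; have [i [n /andP[d0 de]]] := small_rotation e0.
set d := _ + _ in d0 de; pose m := Num.floor (x / d).
have /andP[m1 m2] := floor_itv (x / d).
rewrite ler_pdivlMr // in m1; rewrite ltr_pdivrMr // intrD in m2.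
exists (m * i), (m * n); rewrite !intrM.
have -> : m%:~R * i%:~R * a + m%:~R * n%:~R - x = m%:~R * d - x by rewrite /d; ring.
by rewrite ltr_norml -/m in m1 m2 *; lra.
Qed.

End Irrational.

(** * Minimal actions on unions of circles *)

Section TowerActions.
Variables (R : realType) (I : finType) (G : groupType).
Variable rho : {multiplicative G -> iet R}.
Implicit Types (i j : I) (y : R).

Lemma iet_mulE (f g : iet R) x : (f * g)%g x = f (g x). Proof. by []. Qed.

Lemma iet_invK (f : iet R) x : (f^-1)%g (f x) = x. Proof. exact: iet_funK. Qed.

Lemma iet_Kinv (f : iet R) x : f ((f^-1)%g x) = x. Proof. exact: iet_inv_funK. Qed.

Lemma iet_inj (f : iet R) : injective f. Proof. exact: can_inj (@iet_funK _ f). Qed.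

Lemma zpow_pt (f : iet R) i t (n : int) y :
  (forall y, f (pt i y) = pt i (y + t)) -> zpow f n (pt i y) = pt i (y + n%:~R * t).
Proof.
move=> fE.
have fX k z : (f ^+ k)%g (pt i z) = pt i (z + k%:R * t).
  elim: k z => [|k IHk] z; first by rewrite expg0 /= mul0r addr0.
  by rewrite expgS iet_mulE IHk fE -natr1 mulrDl mul1r addrA.
case: n => k /=; first by rewrite fX.
apply: (@iet_inj (f ^+ k.+1)%g); rewrite iet_Kinv fX NegzE intrN; congr pt.
by rewrite -pmulrn; ring.
Qed.

(** Transitivity on the circles leads to the circle of the target, and there the rotations by
    multiples of [a] are dense. *)
Lemma tower_minimal (a : R) :
    (forall i n : int, i%:~R * a = n%:~R -> i = 0) ->
    (forall i j y, exists g z, rho g (pt i y) = pt j z) ->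
    (forall j y (n : int), exists g, rho g (pt j y) = pt j (y + n%:~R * a)) ->
    (0 < #|I|)%N ->
  minimal_action rho.
Proof.
move=> a_irr trans rot I_gt0 x t; rewrite /= in_itv /= => t01.
have [t' t'E] : {t' : unit_co R | val t' = t} by apply: unit_coP; case/andP: t01.
have I0 : 0 < #|I|%:R :> R by rewrite ltr0n.
rewrite -t'E => {t01 t'E t} B /nbhs_ballP[e /= e0 eB].
have [i [y [_ xE]]] := pt_surj I_gt0 x.
have [j [u [u01 tE]]] := pt_surj I_gt0 t'.
have [g [z gE]] := trans i j y.
(* Aiming at [u + d] keeps the approximation inside [[u, 1)], where it does not wrap around, and
   within [2d <= e] of [u]. *)
pose d := Num.min e (1 - u) / 2.
have d0 : 0 < d by rewrite divr_gt0 // lt_min e0 /=; lra.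
have de : d + d <= e by rewrite -splitr ge_min lexx.
have du : d + d <= 1 - u by rewrite -splitr ge_min lexx orbT.
have [n [m nm]] := rotation_dense a_irr (u + d - z) d0.
have [h hE] := rot j z n.
exists (val (rho (h * g)%g x)); split; first by exists (h * g)%g.
apply: eB; rewrite /ball /= gmulfM iet_mulE xE gE hE tE.
have -> : pt j (z + n%:~R * a) = pt j (z + n%:~R * a + m%:~R).
  by apply/pt_eq; split=> //; exists m.
have valE w : 0 <= w < 1 -> sval (pt j w) = ((enum_rank j)%:R + w) / #|I|%:R.
  by move=> w01; rewrite /= /slot frac_part_id.
rewrite !valE //; last by move: nm; rewrite ltr_norml; lra.
rewrite -mulrBl normrM normfV (gtr0_norm I0) ltr_pdivrMr //.
apply: (@lt_le_trans _ _ e); last by rewrite ler_peMr ?ler1n // ltW.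
by move: nm; rewrite !ltr_norml; lra.
Qed.

End TowerActions.

(** [L] is meant to be a normal subgroup and [E] a set of coset representatives. [LV] says that the
    inverse square of each generator lies in [L], which reduces inverse generators to generators. *)
Lemma coset_normal_form (n : nat) (rels : seq (word n * word n))
    (L E : presented rels -> Prop) (s := fun i => pres_class rels (wgen i)) :
    L 1%g -> E 1%g -> (forall t u, L t -> L u -> L (t * u)%g) ->
    (forall i t, L t -> exists2 u, L u & (s i * t = u * s i)%g) ->
    (forall i e, E e -> exists t f, [/\ L t, E f & (s i * e = t * f)%g]) ->
    (forall i, exists2 t, L t & ((s i)^-1 = t * s i)%g) ->
  forall x, exists t e, [/\ L t, E e & x = (t * e)%g].
Proof.
move=> L1 E1 LM LJ ES LV.
have gen i x : (exists t e, [/\ L t, E e & x = (t * e)%g]) ->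
    exists t e, [/\ L t, E e & (s i * x = t * e)%g].
  move=> [t [e [Lt Ee ->]]]; have [u Lu uE] := LJ i t Lt.
  have [v [f [Lv Ef vE]]] := ES i e Ee.
  by exists (u * v)%g, f; split=> //; [exact: LM|rewrite mulgA uE -!mulgA vE].
apply: presented_ind => [|i x|i x IHx].
- by exists 1%g, 1%g; split=> //; rewrite mulg1.
- exact: gen.
have [t [e [Lt Ee xE]]] := gen i x IHx; have [u Lu uE] := LV i.
by exists (u * t)%g, e; split=> //; [exact: LM|rewrite uE -!mulgA xE].
Qed.

(** * The group BS(1,-1) *)

Section KleinBottle.
Local Notation a := (pres_class _ (wgen (@Ordinal 2 0 isT)) : BS1m1).
Local Notation b := (pres_class _ (wgen (@Ordinal 2 1 isT)) : BS1m1).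

Lemma BS1m1_rel : (b * a = a^-1 * b)%g.
Proof.
have /pres_class_rel := mem_head (wgen (@Ordinal 2 1 isT) ++
  wgen (@Ordinal 2 0 isT) ++ winv (wgen (@Ordinal 2 1 isT)),
  winv (wgen (@Ordinal 2 0 isT))) [::].
by rewrite !pres_class_cat !pres_class_winv => <-; rewrite -!mulgA mulVg mulg1.
Qed.

(** Here [L] consists of the [a^i (b^2)^j] and [E] of 1 and [b]; conjugation by [b] inverts [a] and
    fixes [b^2]. *)
Lemma BS1m1_normal_form (x : BS1m1) : exists (i j : int) (e : bool),
  (x = zpow a i * zpow (b * b) j * (if e then b else 1))%g.
Proof.
suff [t [f [[i [j ->]] [e ->] ->]]] : exists t f : BS1m1,
    [/\ exists i j : int, (t = zpow a i * zpow (b * b) j)%g,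
        exists e : bool, f = if e then b else 1%g & x = (t * f)%g].
  by exists i, j, e.
have bbz j : (b * zpow (b * b) j = zpow (b * b) j * b)%g.
  by apply: zpow_conj; rewrite mulgA.
have bza i : (b * zpow a i = zpow a (- i) * b)%g.
  by rewrite -zpowV; apply: zpow_conj; exact: BS1m1_rel.
have abb : commute a (b * b)%g.
  symmetry; rewrite -mulgA BS1m1_rel mulgA.
  by have := bza (-1); rewrite opprK /= => ->; rewrite -mulgA.
apply: coset_normal_form.
- by exists 0, 0; rewrite mulg1.
- by exists false.
- move=> _ _ [i [j ->]] [k [l ->]]; exists (i + k), (j + l).
  rewrite !zpowD -!mulgA; congr (_ * _)%g; rewrite !mulgA; congr (_ * _)%g.
  exact/commute_zpow/esym.
- case=> [[|[|//]] lt_i] _ [i [j ->]].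
    rewrite (bool_irrelevance lt_i isT); exists (zpow a i * zpow (b * b) j)%g.
      by exists i, j.
    by apply: commuteM; [exact: (commute_zpow 1 i)|exact: (commute_zpow 1 j)].
  rewrite (bool_irrelevance lt_i isT); exists (zpow a (- i) * zpow (b * b) j)%g.
    by exists (- i), j.
  by rewrite mulgA bza -!mulgA bbz.
- case=> [[|[|//]] lt_i] _ [e ->]; rewrite (bool_irrelevance lt_i isT).
    exists a, (if e then b else 1%g); split; last by [].
      by exists 1, 0; rewrite mulg1.
    by exists e.
  case: e.
    exists (b * b)%g, 1%g; split; last by rewrite mulg1.
      by exists 0, 1; rewrite mul1g.
    by exists false.
  exists 1%g, b; split; last by rewrite mulg1 mul1g.
    by exists 0, 0; rewrite mulg1.
  by exists true.
case=> [[|[|//]] lt_i]; rewrite (bool_irrelevance lt_i isT).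
  exists (zpow a (- 2)); first by exists (- 2), 0; rewrite mulg1.
  by rewrite /= expg2 invgM -mulgA mulVg mulg1.
exists (b * b)^-1%g; first by exists 0, (- 1); rewrite mul1g.
by rewrite invgM -mulgA mulVg mulg1.
Qed.

End KleinBottle.

Section KleinBottleAction.
Variable R : realType.

Theorem BS1m1_free_minimal : exists rho : {multiplicative BS1m1 -> iet R},
  free_action rho /\ minimal_action rho.
Proof.
have [al [be [ga ind]]] := exists_independent R.
have {}ind (i j n : int) : i%:~R * al + j%:~R * be = n%:~R -> i = 0 /\ j = 0.
  by move=> E; have [|//] := ind i j 0 n; rewrite mulr0z mul0r addr0.
have B0 : (0 < #|{: bool}|)%N by rewrite card_bool.
(* Induced from <a, b^2>: the circle c stands for the coset of b^c. *)
have [A AE] := tower_iet B0 (fun c : bool => if c then - al else al) (@inj_id bool).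
have [B BE] := tower_iet B0 (fun c : bool => if c then be else 0) negb_inj.
pose gen (i : 'I_2) := if i == 0 :> nat then A else B.
have [|rho rhoE] := @presented_lift 2 [:: (wgen (@Ordinal 2 1 isT) ++
    wgen (@Ordinal 2 0 isT) ++ winv (wgen (@Ordinal 2 1 isT)),
    winv (wgen (@Ordinal 2 0 isT)))] _ gen.
  move=> r; rewrite inE => /eqP ->.
  rewrite /word_eval /word_act /= /gen_act /= !mulg1.
  change (B * (A * B^-1) = A^-1)%g.
  (* The relation in the inverse-free form [a b a = b], which can be checked circle by circle. *)
  suff ABA : (A * (B * A) = B)%g.
    by apply: (mulgI A); rewrite (mulgA B) mulgA ABA !mulgV.
  apply: iet_eq => x; have [c [y [_ ->]]] := pt_surj B0 x.
  by rewrite !iet_mulE AE !BE AE; case: c; apply: pt_congr => //=; ring.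
pose a : BS1m1 := pres_class _ (wgen (@Ordinal 2 0 isT)).
pose b : BS1m1 := pres_class _ (wgen (@Ordinal 2 1 isT)).
have rhoa : rho a = A by rewrite rhoE /word_eval /= /gen_act mulg1.
have rhob : rho b = B by rewrite rhoE /word_eval /= /gen_act mulg1.
have za c i y : zpow A i (pt c y) = pt c (y + i%:~R * (if c then - al else al)).
  by apply: zpow_pt => z; rewrite AE.
have zbb (c : bool) j y : zpow (B * B)%g j (pt c y) = pt c (y + j%:~R * be).
  apply: zpow_pt => z; rewrite iet_mulE !BE negbK.
  by case: c ; apply: pt_congr => //=; ring.
exists rho; split.
  (* A fixed circle excludes the representative [b]; a fixed point then gives an integer relation
     between [al], [be] and 1. *)
  move=> g [x]; have [c [y [_ ->]]] := pt_surj B0 x.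
  have [i [j [e ->]]] := BS1m1_normal_form g.
  rewrite -/a -/b !gmulfM !gmulf_zpow rhoa gmulfM rhob !iet_mulE.
  case: e; first by rewrite rhob BE zbb za => /pt_eq[]; case: c.
  rewrite gmulf_one [iet_one _ _]/= zbb za => /pt_eq[_ [n E]].
  have [] := ind (if c then i else - i) (- j) n.
    by case: c E => E; rewrite ?intrN; lra.
  move=> i0 /eqP; rewrite oppr_eq0 => /eqP ->.
  have -> : i = 0 by case: c i0 {E} => //; lia.
  by rewrite !mulg1.
apply: (@tower_minimal _ bool _ _ al) => //.
- by move=> i n E; have [] := ind i 0 n; rewrite ?mulr0z ?mul0r ?addr0.
- move=> i j y; have [<-|ij] := eqVneq i j.
    by exists 1%g, y; rewrite gmulf_one.
  exists b, (y + if i then be else 0); rewrite rhob BE.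
  by case: i j ij => [] [].
move=> j y n; exists (zpow a (if j then - n else n)).
by rewrite gmulf_zpow rhoa za; case: j; rewrite ?intrN; apply: pt_congr => //=; ring.
Qed.

End KleinBottleAction.

(** * The group C1 *)

Section ThreePowers.
Local Open Scope group_scope.
Variable G : groupType.
Implicit Types (g x y z : G) (i j k : int).

Definition zpow3 x y z i j k : G := zpow x i * (zpow y j * zpow z k).

Lemma zpow3M x y z i j k i' j' k' : commute x y -> commute x z -> commute y z ->
  zpow3 x y z i j k * zpow3 x y z i' j' k' =
  zpow3 x y z (i + i')%R (j + j')%R (k + k')%R.
Proof.
move=> xy xz yz; rewrite /zpow3 !zpowD -!mulgA; congr (_ * _).
rewrite (mulgA (zpow z k)) -(commute_zpow _ _ xz) -mulgA.
rewrite (mulgA (zpow y j)) -(commute_zpow _ _ xy) -mulgA; congr (_ * (_ * _)).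
by rewrite !mulgA (commute_zpow _ _ yz).
Qed.

Lemma zpow3_conj g x y z x' y' z' i j k :
    g * x = x' * g -> g * y = y' * g -> g * z = z' * g ->
  g * zpow3 x y z i j k = zpow3 x' y' z' i j k * g.
Proof.
move=> gx gy gz; rewrite /zpow3 (mulgA g) (zpow_conj i gx) -mulgA.
by rewrite (mulgA g) (zpow_conj j gy) -(mulgA _ g) (zpow_conj k gz) !mulgA.
Qed.

End ThreePowers.

(** * Relations between [p = a^2], [q = b^2] and [r = (ab)^2] *)

Section HantzscheWendtRelations.
Local Open Scope group_scope.
Variables (G : groupType) (a b p q r : G).
Hypotheses (pE : a * a = p) (qE : b * b = q) (rE : a * (b * (a * b)) = r).
Hypotheses (bp : b * p = p^-1 * b) (aq : a * q = q^-1 * a).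

Lemma conj_invr (x y : G) : x * y = y^-1 * x -> x * y^-1 = y * x.
Proof.
by move=> xy; apply: (mulgI y^-1); rewrite mulgA -xy mulKg -mulgA mulgV mulg1.
Qed.

Lemma HW_commute_ap : commute a p. Proof. by rewrite /commute -pE mulgA. Qed.

Lemma HW_commute_bq : commute b q. Proof. by rewrite /commute -qE mulgA. Qed.

Lemma HW_commute_pq : commute p q.
Proof.
by rewrite /commute -{1}pE -mulgA aq mulgA (conj_invr aq) -mulgA pE.
Qed.

Let left_mul (x y z w t : G) : x * y = z * w -> x * (y * t) = z * (w * t).
Proof. by rewrite !mulgA => ->. Qed.

(** Oriented rules for right-nested products: they carry [p] and [q] to the left past [a] and [b],
    and [p] to the left past [q]. *)
Let shift := (fun t => left_mul t HW_commute_ap,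
  fun t => left_mul t (commuteV HW_commute_ap),
  fun t => left_mul t HW_commute_bq,
  fun t => left_mul t (commuteV HW_commute_bq),
  fun t => left_mul t aq, fun t => left_mul t (conj_invr aq),
  fun t => left_mul t bp, fun t => left_mul t (conj_invr bp),
  fun t => left_mul t (commute_sym HW_commute_pq),
  fun t => left_mul t (commuteV (commute_sym HW_commute_pq)),
  fun t => left_mul t (commute_sym (commuteV HW_commute_pq)),
  fun t => left_mul t (commuteV (commute_sym (commuteV HW_commute_pq)))).

Let aat t : a * (a * t) = p * t. Proof. by rewrite mulgA pE. Qed.

Let bbt t : b * (b * t) = q * t. Proof. by rewrite mulgA qE. Qed.

Let rt t : r * t = a * (b * (a * (b * t))). Proof. by rewrite -rE -!mulgA. Qed.

(** Solved for [b a], this is a product of powers of [p], [q], [r] times the coset representative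
    [a b]. *)
Lemma HW_ba : r * (b * a) = p^-1 * q * (a * b).
Proof.
(* The trailing 1 gives the last letter a right factor as well, so that the rules apply to it. *)
rewrite -[b * a]mulg1 -[RHS]mulg1 -!mulgA rt.
by rewrite !(shift, aat, bbt, mulKg, mulVKg).
Qed.

Lemma HW_ar : a * r = r^-1 * a.
Proof.
apply: (mulgI r); rewrite mulVKg.
rewrite -[a * r]mulg1 -[RHS]mulg1 -!mulgA !rt.
by rewrite !(shift, aat, bbt, mulKg, mulVKg).
Qed.

Lemma HW_br : b * r = r^-1 * b.
Proof.
apply: (mulgI r); rewrite mulVKg.
rewrite -[b * r]mulg1 -[RHS]mulg1 -!mulgA !rt.
by rewrite !(shift, aat, bbt, mulKg, mulVKg).
Qed.

Lemma HW_commute_pr : commute p r.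
Proof.
by rewrite /commute -{1}pE -mulgA HW_ar mulgA (conj_invr HW_ar) -mulgA pE.
Qed.

Lemma HW_commute_qr : commute q r.
Proof.
by rewrite /commute -{1}qE -mulgA HW_br mulgA (conj_invr HW_br) -mulgA qE.
Qed.

End HantzscheWendtRelations.

Section HantzscheWendt.
Local Notation a := (pres_class _ (wgen (@Ordinal 2 0 isT)) : C1).
Local Notation b := (pres_class _ (wgen (@Ordinal 2 1 isT)) : C1).
Local Notation p := (a * a)%g.
Local Notation q := (b * b)%g.
Local Notation r := (a * (b * (a * b)))%g.

Lemma C1_rel_bp : (b * p = p^-1 * b)%g.
Proof.
have : pres_class _ (wgen (@Ordinal 2 1 isT) ++ wgen (@Ordinal 2 0 isT) ++
    wgen (@Ordinal 2 0 isT) ++ winv (wgen (@Ordinal 2 1 isT))) =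
    pres_class _ (winv (wgen (@Ordinal 2 0 isT) ++ wgen (@Ordinal 2 0 isT))) :> C1.
  by apply: pres_class_rel; rewrite !inE eqxx.
rewrite !(pres_class_cat, pres_class_winv) => <-.
by rewrite -!mulgA mulVg mulg1.
Qed.

Lemma C1_rel_aq : (a * q = q^-1 * a)%g.
Proof.
have : pres_class _ (wgen (@Ordinal 2 0 isT) ++ wgen (@Ordinal 2 1 isT) ++
    wgen (@Ordinal 2 1 isT) ++ winv (wgen (@Ordinal 2 0 isT))) =
    pres_class _ (winv (wgen (@Ordinal 2 1 isT) ++ wgen (@Ordinal 2 1 isT))) :> C1.
  by apply: pres_class_rel; rewrite !inE eqxx orbT.
rewrite !(pres_class_cat, pres_class_winv) => <-.
by rewrite -!mulgA mulVg mulg1.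
Qed.

(** The translations of the crystallographic group; [C1_rep] below lists the representatives 1, [a],
    [b], [a b] of their cosets. *)
Definition C1_lattice (i j k : int) : C1 := zpow3 p q r i j k.

Definition C1_rep (e : bool * bool) : C1 :=
  ((if e.1 then a else 1) * (if e.2 then b else 1))%g.

Lemma C1_latticeM i j k i' j' k' :
  (C1_lattice i j k * C1_lattice i' j' k' = C1_lattice (i + i') (j + j') (k + k'))%g.
Proof.
have pq := HW_commute_pq erefl C1_rel_aq.
have pr := HW_commute_pr erefl erefl erefl C1_rel_bp C1_rel_aq.
have qr := HW_commute_qr erefl erefl erefl C1_rel_bp C1_rel_aq.
exact: zpow3M.
Qed.

Lemma C1_lattice_a i j k : (a * C1_lattice i j k = C1_lattice i (- j) (- k) * a)%g.
Proof.
have ar := HW_ar erefl erefl erefl C1_rel_bp C1_rel_aq.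
rewrite /C1_lattice (zpow3_conj _ _ _ (HW_commute_ap erefl) C1_rel_aq ar).
by rewrite /zpow3 !zpowV.
Qed.

Lemma C1_lattice_b i j k : (b * C1_lattice i j k = C1_lattice (- i) j (- k) * b)%g.
Proof.
have br := HW_br erefl erefl erefl C1_rel_bp C1_rel_aq.
rewrite /C1_lattice (zpow3_conj _ _ _ C1_rel_bp (HW_commute_bq erefl) br).
by rewrite /zpow3 !zpowV.
Qed.

Lemma C1_normal_form (x : C1) : exists (i j k : int) (e : bool * bool),
  (x = C1_lattice i j k * C1_rep e)%g.
Proof.
suff [t [f [[i [j [k ->]]] [e ->] ->]]] : exists t f : C1,
    [/\ exists i j k, t = C1_lattice i j k, exists e, f = C1_rep e & x = (t * f)%g].
  by exists i, j, k, e.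
have L1 : exists i j k, 1%g = C1_lattice i j k.
  by exists 0, 0, 0; rewrite /C1_lattice /zpow3 !mulg1.
apply: coset_normal_form => //.
- by exists (false, false); rewrite /C1_rep mulg1.
- move=> _ _ [i [j [k ->]]] [i' [j' [k' ->]]].
  by exists (i + i'), (j + j'), (k + k'); rewrite C1_latticeM.
- case=> [[|[|//]] lt_i] _ [i [j [k ->]]]; rewrite (bool_irrelevance lt_i isT).
    by exists (C1_lattice i (- j) (- k)); [exists i, (- j), (- k)|exact: C1_lattice_a].
  by exists (C1_lattice (- i) j (- k)); [exists (- i), j, (- k)|exact: C1_lattice_b].
- case=> [[|[|//]] lt_i] _ [[e f] ->]; rewrite (bool_irrelevance lt_i isT) /C1_rep /=.
    case: e; last first.
      exists 1%g, (C1_rep (true, f)); split; rewrite ?mul1g //.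
      by exists (true, f).
    exists (C1_lattice 1 0 0), (C1_rep (false, f)); split.
    + by exists 1, 0, 0.
    + by exists (false, f).
    + by rewrite /C1_lattice /zpow3 /C1_rep /= !mulg1 mul1g mulgA.
  case: e; last first.
    case: f; last first.
      exists 1%g, (C1_rep (false, true)); split; rewrite /C1_rep /= ?mul1g ?mulg1 //.
      by exists (false, true); rewrite /C1_rep /= mul1g.
    exists (C1_lattice 0 1 0), (C1_rep (false, false)); split.
    + by exists 0, 1, 0.
    + by exists (false, false).
    + by rewrite /C1_lattice /zpow3 /C1_rep /= !mulg1 !mul1g.
  have ba : (b * a = C1_lattice (- 1) 1 (- 1) * (a * b))%g.
    have rE : r = C1_lattice 0 0 1 by rewrite /C1_lattice /zpow3 !mul1g.
    have rL : (r * C1_lattice (- 1) 1 (- 1) = C1_lattice (- 1) 1 0)%g.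
      by rewrite rE C1_latticeM.
    have pqE : (p^-1 * q = C1_lattice (- 1) 1 0)%g.
      by rewrite /C1_lattice /zpow3 /= mulg1.
    apply: (mulgI r); rewrite [RHS]mulgA rL -pqE.
    exact: (HW_ba erefl erefl erefl C1_rel_bp C1_rel_aq).
  case: f.
    (* [b a b = p^-1 q r^-1 a b^2]; the last factor [q] becomes [q^-1] on its way past [a] and
       cancels the other [q]. *)
    exists (C1_lattice (- 1) 0 (- 1)), (C1_rep (true, false)); split.
    + by exists (- 1), 0, (- 1).
    + by exists (true, false).
    have qE : q = C1_lattice 0 1 0 by rewrite /C1_lattice /zpow3 mul1g mulg1.
    have aqE : (a * q = C1_lattice 0 (- 1) 0 * a)%g by rewrite qE C1_lattice_a.
    have E : (C1_lattice (- 1) 1 (- 1) * C1_lattice 0 (- 1) 0 =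
      C1_lattice (- 1) 0 (- 1))%g by rewrite C1_latticeM.
    by rewrite mulgA ba -E /C1_rep /= mulg1 -[RHS]mulgA -aqE !mulgA.
  exists (C1_lattice (- 1) 1 (- 1)), (C1_rep (true, true)); split.
  + by exists (- 1), 1, (- 1).
  + by exists (true, true).
  + by rewrite mulg1 ba.
case=> [[|[|//]] lt_i]; rewrite (bool_irrelevance lt_i isT).
  exists (C1_lattice (- 1) 0 0); first by exists (- 1), 0, 0.
  by rewrite /C1_lattice /zpow3 /= !mulg1 expg1 invgM -mulgA mulVg mulg1.
exists (C1_lattice 0 (- 1) 0); first by exists 0, (- 1), 0.
by rewrite /C1_lattice /zpow3 /= mul1g !mulg1 expg1 invgM -mulgA mulVg mulg1.
Qed.

End HantzscheWendt.

Section HantzscheWendtAction.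
Variable R : realType.

Theorem C1_free_minimal : exists rho : {multiplicative C1 -> iet R},
  free_action rho /\ minimal_action rho.
Proof.
have [al [be [ga ind]]] := exists_independent R.
have B0 : (0 < #|{: bool * bool}|)%N by rewrite card_prod card_bool.
(* Induced from <a^2, b^2, (ab)^2>: the circle (e, e') stands for the coset of
   a^e b^e'; the angles come from b a = r^-1 p^-1 q a b with p = a^2, q = b^2,
   r = (ab)^2. *)
pose sa (c : bool * bool) := (~~ c.1, c.2).
pose sb (c : bool * bool) := (c.1, ~~ c.2).
pose tha (c : bool * bool) : R :=
  if c.1 then (if c.2 then - al else al) else 0.
pose thb (c : bool * bool) : R :=
  if c.1 then (if c.2 then ga - al else al - be - ga) else (if c.2 then be else 0).
have [A AE] : exists f : iet R, forall c y, f (pt c y) = pt (sa c) (y + tha c).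
  by apply: (tower_iet B0) => -[[] []] [[] []].
have [B BE] : exists f : iet R, forall c y, f (pt c y) = pt (sb c) (y + thb c).
  by apply: (tower_iet B0) => -[[] []] [[] []].
pose gen (i : 'I_2) := if i == 0 :> nat then A else B.
have pt4 (f g : iet R) : (forall (c : bool * bool) y, f (pt c y) = g (pt c y)) -> f = g.
  by move=> fg; apply: iet_eq => x; have [c [y [_ ->]]] := pt_surj B0 x.
(* [p], [q] and [r] preserve every circle; their angle changes sign when the coset representative of
   the circle conjugates them to their inverses. *)
have AAE (c : bool * bool) y : (A * A)%g (pt c y) = pt c (y + if c.2 then - al else al).
  by rewrite iet_mulE !AE; case: c => [[] []]; apply: pt_congr => //; rewrite /tha /=; ring.
have BBE (c : bool * bool) y : (B * B)%g (pt c y) = pt c (y + if c.1 then - be else be).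
  by rewrite iet_mulE !BE; case: c => [[] []]; apply: pt_congr => //; rewrite /thb /=; ring.
have ABE (c : bool * bool) y : (A * (B * (A * B)))%g (pt c y) =
    pt c (y + if c.1 (+) c.2 then - ga else ga).
  rewrite !iet_mulE BE AE BE AE.
  by case: c => [[] []]; apply: pt_congr => //; rewrite /tha /thb /=; ring.
have rels1 : (B * (A * (A * B^-1)) = (A * A)^-1)%g.
  have E : (A * A * (B * (A * A)) = B)%g.
    apply: pt4 => c y; rewrite iet_mulE (iet_mulE B) AAE !BE AAE.
    by case: c => [[] []]; apply: pt_congr => //=; ring.
  by apply: (mulgI (A * A)%g); rewrite (mulgA A A) (mulgA B) (mulgA (A * A)%g) E !mulgV.
have rels2 : (A * (B * (B * A^-1)) = (B * B)^-1)%g.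
  have E : (B * B * (A * (B * B)) = A)%g.
    apply: pt4 => c y; rewrite iet_mulE (iet_mulE A) BBE !AE BBE.
    by case: c => [[] []]; apply: pt_congr => //=; ring.
  by apply: (mulgI (B * B)%g); rewrite (mulgA B B) (mulgA A) (mulgA (B * B)%g) E !mulgV.
have [|rho rhoE] := @presented_lift 2 [::
    (wgen (@Ordinal 2 1 isT) ++ wgen (@Ordinal 2 0 isT) ++
      wgen (@Ordinal 2 0 isT) ++ winv (wgen (@Ordinal 2 1 isT)),
     winv (wgen (@Ordinal 2 0 isT) ++ wgen (@Ordinal 2 0 isT)));
    (wgen (@Ordinal 2 0 isT) ++ wgen (@Ordinal 2 1 isT) ++
      wgen (@Ordinal 2 1 isT) ++ winv (wgen (@Ordinal 2 0 isT)),
     winv (wgen (@Ordinal 2 1 isT) ++ wgen (@Ordinal 2 1 isT)))] _ gen.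
  move=> r; rewrite !inE => /orP[] /eqP ->;
    rewrite /word_eval /word_act /= /gen_act /= !mulg1 -invgM.
  - exact: rels1.
  - exact: rels2.
pose a : C1 := pres_class _ (wgen (@Ordinal 2 0 isT)).
pose b : C1 := pres_class _ (wgen (@Ordinal 2 1 isT)).
have rhoa : rho a = A by rewrite rhoE /word_eval /= /gen_act mulg1.
have rhob : rho b = B by rewrite rhoE /word_eval /= /gen_act mulg1.
have latE i j k (c : bool * bool) y : rho (C1_lattice i j k) (pt c y) =
    pt c (y + (i%:~R * (if c.2 then - al else al) +
      (j%:~R * (if c.1 then - be else be) +
       k%:~R * (if c.1 (+) c.2 then - ga else ga)))).
  rewrite /C1_lattice /zpow3 -/a -/b !gmulfM !gmulf_zpow !gmulfM rhoa rhob !iet_mulE.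
  have zp (f : iet R) t n z : (forall y, f (pt c y) = pt c (y + t)) ->
    zpow f n (pt c z) = pt c (z + n%:~R * t) by exact: zpow_pt.
  rewrite (zp _ _ _ _ (ABE c)) (zp _ _ _ _ (BBE c)) (zp _ _ _ _ (AAE c)).
  by apply: pt_congr => //; ring.
have repE e (c : bool * bool) y :
    exists z, rho (C1_rep e) (pt c y) = pt (c.1 (+) e.1, c.2 (+) e.2) z.
  rewrite /C1_rep -/a -/b gmulfM iet_mulE.
  case: e => [[] []] /=; rewrite ?rhoa ?rhob ?gmulf_one /= ?AE ?BE ?AE;
    by eexists; apply: pt_congr; [case: c => [[] []]|reflexivity].
exists rho; split.
  move=> g [x]; have [c [y [_ ->]]] := pt_surj B0 x.
  have [i [j [k [e ->]]]] := C1_normal_form g.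
  rewrite gmulfM iet_mulE => E.
  (* A nontrivial representative moves every circle. *)
  have e0 : e = (false, false).
    have [z zE] := repE e c y; move: E; rewrite zE latE => /pt_eq[].
    by case: c {zE} => [[] []]; case: e => [[] []].
  move: E; rewrite e0 [C1_rep _](_ : _ = 1%g) ?gmulf_one; last by rewrite /C1_rep mulg1.
  rewrite latE => /pt_eq[_ [n E]].
  (* [sg] moves the signs of the angles on the circle [c] onto the exponents, so that independence
     applies. *)
  pose sg (s : bool) (m : int) := if s then m else - m.
  have sg0 s m : sg s m = 0 -> m = 0 by rewrite /sg; case: s => //; lia.
  have [|/sg0-> /sg0-> /sg0->] := ind (sg c.2 i) (sg c.1 j) (sg (c.1 (+) c.2) k) n.
    by rewrite /sg; case: c E => [[] []] /= E; rewrite ?intrN; lra.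
  by rewrite /C1_lattice /zpow3 !mulg1.
apply: (@tower_minimal _ _ _ _ al _ _ _ B0).
- by move=> i n E; have [] := ind i 0 0 n; rewrite ?mulr0z ?mul0r ?addr0.
- move=> c d y; have [z zE] := repE (c.1 (+) d.1, c.2 (+) d.2) c y.
  exists (C1_rep (c.1 (+) d.1, c.2 (+) d.2)), z.
  by rewrite zE /= !addKb -surjective_pairing.
move=> c y n; exists (C1_lattice (if c.2 then - n else n) 0 0).
by rewrite latE; case: c.2; rewrite ?intrN; apply: pt_congr => //; ring.
Qed.

End HantzscheWendtAction.

(** * Powers that act through a commutative monoid *)

Section CommutingMaps.
Variables (X J : Type) (T : J -> X -> X).
Hypothesis T_comm : forall i j x, T i (T j x) = T j (T i x).
Hypothesis T_inj : forall i, injective (T i).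
Implicit Types (x y : X) (s t : seq J) (g h : X -> X).

Definition run s x := foldr T x s.

(** Equivalence under the group generated by [T], expressed by a common image because the maps are
    only assumed injective. Commutativity makes it transitive. *)
Definition linked x y := exists s t, run s x = run t y.

Lemma run_cat s t x : run (s ++ t) x = run s (run t x).
Proof. by rewrite /run foldr_cat. Qed.

Lemma run_inj s : injective (run s).
Proof. by elim: s => [//|i s IHs] x y /= /T_inj/IHs. Qed.

Lemma run_comm1 g s x : (forall i x, g (T i x) = T i (g x)) ->
  g (run s x) = run s (g x).
Proof. by move=> gT; elim: s => [//|i s IHs] /=; rewrite gT IHs. Qed.

Lemma run_comm s t x : run s (run t x) = run t (run s x).
Proof. by apply: run_comm1 => i y; rewrite (run_comm1 _ _ (T_comm i)). Qed.

Lemma linked_sym x y : linked x y -> linked y x.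
Proof. by case=> s [t st]; exists t, s. Qed.

Lemma linked_trans y x z : linked x y -> linked y z -> linked x z.
Proof.
move=> [s [t xy]] [s' [t' yz]]; exists (s' ++ s), (t ++ t').
by rewrite !run_cat xy run_comm yz.
Qed.

Section Commutant.
Variable g : X -> X.
Hypotheses (gT : forall i x, g (T i x) = T i (g x)) (g_inj : injective g).

Lemma linked_iter n x y : linked x y <-> linked (iter n g x) (iter n g y).
Proof.
elim: n => [//|n IHn]; rewrite IHn /=; split=> -[s [t st]]; exists s, t.
  by rewrite -!(run_comm1 _ _ gT) st.
by apply: g_inj; rewrite !(run_comm1 _ _ gT).
Qed.

Lemma linked_iter_mul n k x : linked x (iter n g x) -> linked x (iter (k * n) g x).
Proof.
move=> xn; elim: k => [|k IHk]; first by exists [::], [::].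
apply: (linked_trans xn); rewrite mulSn iterD.
exact: (linked_iter n x _).1.
Qed.

(** Two of [k + 1] iterates of [g] fall into the same of [k] classes; cancelling the earlier one
    leaves a period of at most [k], which divides [k!]. *)
Lemma linked_periodic (S : X -> Prop) k (reps : 'I_k -> X) x :
    (forall y, S y -> S (g y)) ->
    (forall y, S y -> exists i, linked y (reps i)) ->
  S x -> linked x (iter k`! g x).
Proof.
move=> gS repsP Sx.
have Sn n : S (iter n g x) by elim: n => //= n; exact: gS.
have /choice[c cP] n := repsP _ (Sn n).
have /injectivePn[i [j ij cij]] : ~~ injectiveb (fun n : 'I_k.+1 => c n).
  by apply/negP => /injectiveP/leq_card; rewrite !card_ord ltnn.
suff main (m n : nat) : (m < n)%N -> (n <= k)%N -> c m = c n ->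
    linked x (iter k`! g x).
  have := ltn_ord i; have := ltn_ord j; rewrite !ltnS => jk ik.
  by case: (ltngtP i j) ij => [lt _|lt _|/val_inj->]; rewrite ?eqxx //;
    [exact: main lt jk cij | exact: main lt ik (esym cij)].
move=> mn nk cmn.
have : linked (iter m g x) (iter m g (iter (n - m) g x)).
  rewrite -iterD subnKC ?(ltnW mn) //; apply: linked_trans (cP m) _.
  by rewrite cmn; exact/linked_sym/cP.
move=> /(linked_iter m _ _).2 xd.
have /dvdnP[q ->] : (n - m %| k`!)%N by apply: dvdn_fact; lia.
exact: linked_iter_mul.
Qed.

End Commutant.

(* On each T-orbit a power of g and a power of h act as elements of the
   commutative monoid generated by T. *)
Lemma powers_commute (S : X -> Prop) k (reps : 'I_k -> X) g h :
    (forall i x, g (T i x) = T i (g x)) -> injective g ->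
    (forall i x, h (T i x) = T i (h x)) -> injective h ->
    (forall y, S y -> S (g y)) -> (forall y, S y -> S (h y)) ->
    (forall y, S y -> exists i, linked y (reps i)) ->
  forall x, S x ->
    iter k`! g (iter k`! h x) = iter k`! h (iter k`! g x).
Proof.
move=> gT g_inj hT h_inj gS hS repsP x Sx.
have [s [t st]] := linked_periodic gT g_inj gS repsP Sx.
have [s' [t' st']] := linked_periodic hT h_inj hS repsP Sx.
set u := iter _ g in st *; set v := iter _ h in st' *.
have iterT f n : (forall i x, f (T i x) = T i (f x)) ->
    forall i x, iter n f (T i x) = T i (iter n f x).
  by move=> fT i y; elim: n => //= n ->; rewrite fT.
have uT s0 y : u (run s0 y) = run s0 (u y) by apply/run_comm1/iterT.
have vT s0 y : v (run s0 y) = run s0 (v y) by apply/run_comm1/iterT.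
(* At [x], [u] acts as the fraction [s/t] and [v] as [s'/t']; with denominators cleared both sides
   equal [run s (run s' x)]. *)
apply: (@run_inj (t ++ t')); rewrite !run_cat.
transitivity (run s (run s' x)).
  by rewrite -uT -st' uT run_comm -st run_comm.
by rewrite (run_comm t) -(vT t) -st vT (run_comm t') -st'.
Qed.

End CommutingMaps.

(** * Left germs and their gluing to right germs *)

Section LeftLimits.
Variable R : realType.

(* [z : unit_oc R] stands for the left-hand germ at z; [lmap f] is the action
   of f on these germs. *)
Definition unit_oc := {x : R | 0 < x <= 1}.

Implicit Types (f g : iet R) (x y : unit_co R) (z w : unit_oc).

Lemma unit_ocP (r : R) : 0 < r -> r <= 1 -> {z : unit_oc | val z = r}.
Proof. by move=> r0 r1; have rP : 0 < r <= 1 by [rewrite r0]; exists (exist _ r rP). Qed.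

Definition left_limit f z w := exists p : R, [/\ 0 <= p, p < val z &
  forall x, p <= val x -> val x < val z -> val (f x) = val w - (val z - val x)].

Lemma rigid_left_limit f B z : rigid f B -> exists w, left_limit f z w.
Proof.
move=> fB; have /andP[z0 z1] := valP z.
have [p [p0 pz pB]] := prev_break B z0.
have [x xE] := unit_coP p0 (lt_le_trans pz z1).
have step y : p <= val y -> val y < val z ->
    val (f y) = val (f x) + (val z - p) - (val z - val y).
  move=> py yz; rewrite (fB x y) ?xE //; last first.
    by move=> b bB pb; exact: lt_le_trans yz (pB b bB pb).
  by lra.
have /andP[fx0 fx1] := valP (f x).
have w1 : val (f x) + (val z - p) <= 1.
  rewrite leNgt; apply/negP => gt1.
  (* Were the limit above 1, points this close to [z] would already have images at least 1. *)
  pose r := Num.max p (val z - (val (f x) + (val z - p) - 1)).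
  have pr : p <= r by rewrite le_max lexx.
  have rz : r < val z by rewrite gt_max pz; lra.
  have rw : val z - (val (f x) + (val z - p) - 1) <= r by rewrite le_max lexx orbT.
  have [y yE] := unit_coP (le_trans p0 pr) (lt_le_trans rz z1).
  have := step y; rewrite yE => /(_ pr rz) fyE.
  by have /andP[_] := valP (f y); rewrite fyE; lra.
have w0 : 0 < val (f x) + (val z - p) by lra.
have [w wE] := unit_ocP w0 w1.
by exists w, p; split=> // y py yz; rewrite wE; exact: step.
Qed.

Lemma left_limit_ex f z : exists w, left_limit f z w.
Proof. by have [B fB] := pw_rigid (iet_pw f); exact: rigid_left_limit fB. Qed.

Definition lmap f z : unit_oc := projT1 (cid (left_limit_ex f z)).

Lemma lmapP f z : left_limit f z (lmap f z).
Proof. exact: projT2 (cid (left_limit_ex f z)). Qed.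

Lemma left_limit_unique f z w w' : left_limit f z w -> left_limit f z w' -> w = w'.
Proof.
have /andP[_ z1] := valP z.
move=> [p [p0 pz pw]] [p' [p'0 p'z p'w]]; apply: val_inj.
have r0 : 0 <= Num.max p p' by rewrite le_max p0.
have rz : Num.max p p' < val z by rewrite gt_max pz p'z.
have [x xE] := unit_coP r0 (lt_le_trans rz z1).
have := pw x; rewrite xE le_max lexx => /(_ isT rz) fx.
by have := p'w x; rewrite xE le_max lexx orbT fx => /(_ isT rz); lra.
Qed.

Lemma lmapE f z w : left_limit f z w -> lmap f z = w.
Proof. by move=> fzw; exact: left_limit_unique (lmapP f z) fzw. Qed.

Lemma lmapM f g z : lmap (f * g)%g z = lmap f (lmap g z).
Proof.
apply: lmapE; have /andP[_ z1] := valP z.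
have [p [p0 pz pw]] := lmapP g z; have [q [q0 qz qw]] := lmapP f (lmap g z).
exists (Num.max p (val z - (val (lmap g z) - q))); split.
- by rewrite le_max p0.
- by rewrite gt_max pz; lra.
move=> x; rewrite ge_max => /andP[px qx] xz.
have gx := pw x px xz.
by rewrite iet_mulE qw gx; lra.
Qed.

Lemma lmap1 z : lmap 1%g z = z.
Proof.
apply: lmapE; have /andP[z0 _] := valP z.
by exists 0; split=> // x _ _ /=; lra.
Qed.

Lemma lmapK f : cancel (lmap f) (lmap f^-1%g).
Proof. by move=> z; rewrite -lmapM mulVg lmap1. Qed.

Lemma lmap_inj f : injective (lmap f).
Proof. exact: can_inj (lmapK f). Qed.

Lemma lmap_rigid f B x z : rigid f B -> val x < val z ->
    (forall b, b \in B -> val x < b -> val z <= b) ->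
  val (lmap f z) = val (f x) + (val z - val x).
Proof.
move=> fB xz nb; have /andP[x0 _] := valP x; have /andP[_ z1] := valP z.
have [p [p0 pz pw]] := lmapP f z.
have r0 : 0 <= Num.max p (val x) by rewrite le_max p0.
have rz : Num.max p (val x) < val z by rewrite gt_max pz xz.
have [y yE] := unit_coP r0 (lt_le_trans rz z1).
have := pw y; rewrite yE le_max lexx => /(_ isT rz).
rewrite (fB x y) ?yE ?le_max ?lexx ?orbT //; first by lra.
by move=> b bB xb; exact: lt_le_trans rz (nb b bB xb).
Qed.

(** Off the breaks [f] is continuous, so it sends a left germ and the point at the same place to the
    same place. *)
Lemma lmap_unbroken f B x z : rigid f B -> val x = val z -> val x \notin B ->
  val (lmap f z) = val (f x).
Proof.
move=> fB xz xB; have /andP[z0 z1] := valP z.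
have [p [p0 pz pB]] := prev_break B z0.
have [y yE] := unit_coP p0 (lt_le_trans pz z1).
rewrite (lmap_rigid fB (x := y)) ?yE ?xz // (fB y x) ?yE -?xz //.
  by rewrite ltW // xz.
move=> b bB pb; rewrite lt_def xz pB // andbT.
by apply: contraNneq xB => bz; rewrite xz -bz.
Qed.

(** A fixed left germ means that [f] is the identity on some [[p, z)]; thus aperiodicity extends to
    left germs. *)
Lemma lmap_fixed f z : lmap f z = z -> exists x, f x = x.
Proof.
move=> fz; have /andP[_ z1] := valP z.
have [p [p0 pz pw]] := lmapP f z.
have [x xE] := unit_coP p0 (lt_le_trans pz z1).
exists x; apply: val_inj; rewrite pw ?xE ?fz //; lra.
Qed.

End LeftLimits.

(** * Gluing of germs along forward and backward orbits *)

Section Asymptotics.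
Variable R : realType.
Implicit Types (f g : iet R) (x y : unit_co R) (z w : unit_oc R) (B : seq R).

Definition aperiodic f := forall n x, (f ^+ n.+1)%g x <> x.

Lemma aperiodicV f : aperiodic f -> aperiodic f^-1%g.
Proof.
move=> ap n x; rewrite expVgn => fx; apply: (ap n x).
by rewrite -{1}fx iet_Kinv.
Qed.

Lemma aperiodic_inj f x : aperiodic f -> injective (fun n => val ((f ^+ n)%g x)).
Proof.
move=> ap; have lt m n : (m < n)%N -> val ((f ^+ m)%g x) <> val ((f ^+ n)%g x).
  move=> mn /val_inj; rewrite -(subnKC (ltnW mn)) expgnDr iet_mulE => /iet_inj /esym.
  by rewrite -[(n - m)%N]prednK ?subn_gt0 //; exact: ap.
by move=> m n E; case: (ltngtP m n) => // [/lt|/lt/nesym]; case.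
Qed.

Lemma aperiodic_lmap_inj f z :
  aperiodic f -> injective (fun n => val (lmap (f ^+ n)%g z)).
Proof.
move=> ap; have lt m n : (m < n)%N ->
    val (lmap (f ^+ m)%g z) <> val (lmap (f ^+ n)%g z).
  move=> mn /val_inj; rewrite -(subnKC (ltnW mn)) expgnDr lmapM => /lmap_inj /esym.
  rewrite -[(n - m)%N]prednK ?subn_gt0 // => /lmap_fixed[x].
  exact: ap.
by move=> m n E; case: (ltngtP m n) => // [/lt|/lt/nesym]; case.
Qed.

Lemma eventually_notin (u : nat -> R) B : injective u ->
  exists n0, forall n, (n0 <= n)%N -> u n \notin B.
Proof.
move=> u_inj; elim: B => [|b B [n0 n0P]]; first by exists 0%N.
have [[k kb]|nb] := pselect (exists k, u k = b); last first.
  exists n0 => n n0n; rewrite inE negb_or n0P // andbT.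
  by apply/eqP => ub; apply: nb; exists n.
exists (maxn n0 k.+1) => n; rewrite geq_max => /andP[n0n kn].
rewrite inE negb_or n0P // andbT -kb; apply: contraTN kn => /eqP/u_inj ->.
by rewrite -leqNgt.
Qed.

(* Under forward iteration of f, the germ to the right of x and the germ to the
   left of z eventually stay at a common point. *)
Definition asymptotic f x z := exists n0, forall n, (n0 <= n)%N ->
  val ((f ^+ n)%g x) = val (lmap (f ^+ n)%g z).

Lemma iterates_glued f B x z n0 : rigid f B -> val x = val z ->
    (forall n, (n < n0)%N -> val ((f ^+ n)%g x) \notin B) ->
  val ((f ^+ n0)%g x) = val (lmap (f ^+ n0)%g z).
Proof.
move=> fB xz; elim: n0 => [|n IHn] nb; first by rewrite lmap1.
rewrite expgS iet_mulE lmapM (lmap_unbroken fB (x := (f ^+ n)%g x)) ?nb //.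
by apply: IHn => k kn; apply: nb; exact: ltnW.
Qed.

Lemma asymptotic_glued f B x z : rigid f B -> val x = val z ->
  (forall n, val ((f ^+ n)%g x) \notin B) -> asymptotic f x z.
Proof. by move=> fB xz nb; exists 0%N => n _; apply: (iterates_glued fB). Qed.

Lemma asymptotic_shift f m x z :
  asymptotic f ((f ^+ m)%g x) (lmap (f ^+ m)%g z) -> asymptotic f x z.
Proof.
case=> n0 n0P; exists (n0 + m)%N => n n0n.
have -> : n = (n - m + m)%N by lia.
by rewrite expgnDr iet_mulE lmapM; apply: n0P; lia.
Qed.

(** Once the orbit of the left germ has left the breaks for good, the point at its place follows it
    forever; pulling that point back by [f ^+ m] gives [x]. *)
Lemma asymptotic_left f z : aperiodic f -> exists x, asymptotic f x z.
Proof.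
move=> ap; have [B fB] := pw_rigid (iet_pw f).
(* 1 is listed because it carries a left germ but is not a point of [[0, 1)]. *)
have [m mP] := eventually_notin (1 :: B) (aperiodic_lmap_inj (z := z) ap).
have /andP[y0 y1] := valP (lmap (f ^+ m)%g z).
have ylt1 : val (lmap (f ^+ m)%g z) < 1.
  rewrite lt_def y1 andbT eq_sym.
  by have := mP m (leqnn m); rewrite inE negb_or => /andP[].
have [y yE] := unit_coP (ltW y0) ylt1.
exists ((f ^+ m)^-1%g y); apply: (asymptotic_shift (m := m)).
rewrite iet_Kinv; exists 0%N => n _; elim: n => [|n IHn]; first by rewrite lmap1.
rewrite expgS iet_mulE lmapM (lmap_unbroken fB (x := (f ^+ n)%g y)) // IHn.
rewrite -lmapM -expgnDr.
by have := mP (n + m)%N (leq_addl _ _); rewrite inE negb_or => /andP[].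
Qed.

Lemma asymptotic_fun f x z z' : asymptotic f x z -> asymptotic f x z' -> z = z'.
Proof.
move=> [m mP] [n nP]; apply: (@lmap_inj _ (f ^+ maxn m n)%g); apply: val_inj.
by rewrite -mP ?nP // ?leq_maxl ?leq_maxr.
Qed.

Lemma asymptotic_inj f x x' z : asymptotic f x z -> asymptotic f x' z -> x = x'.
Proof.
move=> [m mP] [n nP]; apply: (@iet_inj _ (f ^+ maxn m n)%g); apply: val_inj.
by rewrite mP ?nP // ?leq_maxl ?leq_maxr.
Qed.

(** Aperiodicity drives the orbit of [x] off the breaks of [g], where [g] treats both germs
    alike. *)
Lemma asymptotic_equivariant f f' g x z : aperiodic f -> (g * f = f' * g)%g ->
  asymptotic f x z -> asymptotic f' (g x) (lmap g z).
Proof.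
move=> ap gf [m mP]; have [B gB] := pw_rigid (iet_pw g).
have gfn n : (g * f ^+ n = f' ^+ n * g)%g by exact: (zpow_conj n gf).
have [k kP] := eventually_notin B (aperiodic_inj (x := x) ap).
exists (maxn m k) => n; rewrite geq_max => /andP[mn kn].
rewrite -iet_mulE -lmapM -gfn iet_mulE lmapM.
by rewrite (lmap_unbroken gB (x := (f ^+ n)%g x)) ?kP // mP.
Qed.

Definition biasymptotic f x z := asymptotic f x z /\ asymptotic f^-1%g x z.

(** A [g] that inverts [f] exchanges the forward and the backward gluing. *)
Lemma biasymptotic_equivariant f g x z : aperiodic f ->
    (g * f = f * g)%g \/ (g * f = f^-1 * g)%g ->
  biasymptotic f x z -> biasymptotic f (g x) (lmap g z).
Proof.
move=> ap gf [fxz fVxz]; have apV := aperiodicV ap; case: gf => gf.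
  split; [exact: asymptotic_equivariant gf fxz|].
  by apply: asymptotic_equivariant fVxz => //; exact: (zpow_conj (- 1) gf).
split; last exact: asymptotic_equivariant gf fxz.
apply: asymptotic_equivariant fVxz => //.
by have := zpow_conj (- 1) gf; rewrite zpowV /= expg1.
Qed.

(* The points of the f-orbits along which the forward and the backward gluing
   differ. *)
Definition defective f x := ~ exists z, biasymptotic f x z.

Lemma defective_equivariant f g x : aperiodic f ->
    (g * f = f * g)%g \/ (g * f = f^-1 * g)%g ->
  defective f x -> defective f (g x).
Proof.
move=> ap gf bad [z bz]; apply: bad; exists (lmap g^-1%g z).
rewrite -(iet_invK g x); apply: biasymptotic_equivariant => //.
have conjV f' : (g * f = f' * g)%g -> (g^-1 * f' = f * g^-1)%g.
  by move=> E; apply: (mulgI g); rewrite mulVKg mulgA E mulgK.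
case: gf => [/conjV|/conjV E]; [by left|right].
by have := zpow_conj (- 1) E; rewrite /= !expg1 invgK.
Qed.

(** Along an orbit that avoids 0 and the breaks of [f] and [f^-1], the two germs at [x] are never
    separated; so a defective orbit meets the finite list [L]. *)
Lemma defective_orbits f : aperiodic f -> exists k (reps : 'I_k -> unit_co R),
  forall x, defective f x -> exists n i,
    (f ^+ n)%g x = reps i \/ (f ^+ n)%g (reps i) = x.
Proof.
move=> ap; have [B fB] := pw_rigid (iet_pw f).
have [B' fB'] := pw_rigid (iet_pw f^-1%g).
have [e0 _] := @unit_coP R 0 (lexx 0) ltr01.
pose L := 0 :: B ++ B'.
exists (size L), (fun i => insubd e0 L`_i) => x bad.
suff [n [nb|nb]] : exists n, val ((f ^+ n)%g x) \in L \/ val ((f ^- n)%g x) \in L.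
- have /(nthP 0)[i ilt iE] := nb; exists n, (Ordinal ilt); left.
  by rewrite /= iE valKd.
- have /(nthP 0)[i ilt iE] := nb; exists n, (Ordinal ilt); right.
  by rewrite /= iE valKd iet_Kinv.
apply/not_existsP => nL; apply: bad.
have /andP[x0 x1] := valP x.
have xgt0 : 0 < val x.
  rewrite lt_def x0 andbT; apply/negP => /eqP xE; apply: (nL 0%N); left.
  by rewrite expg0 /= /L [sval x]xE inE eqxx.
have [z zE] := unit_ocP xgt0 (ltW x1).
exists z; split; [apply: (asymptotic_glued fB)|apply: (asymptotic_glued fB')];
  rewrite ?zE // => n; apply/negP => nB; apply: (nL n); [left|right].
  by rewrite /L inE mem_cat nB orbT.
by rewrite -expVgn /L inE mem_cat nB !orbT.
Qed.

(* [kappa] turns [0, 1) into a finite union of circles. *)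
Lemma asymptotic_gluing f : aperiodic f -> (forall x, ~ defective f x) ->
  exists (kappa : unit_oc R -> unit_co R) (D : seq R),
    [/\ forall z, biasymptotic f (kappa z) z, injective kappa &
        forall z, val z \notin D -> val (kappa z) = val z].
Proof.
move=> ap nd.
have /choice[kappa kP] z : exists x, biasymptotic f x z.
  have [x fxz] := asymptotic_left z ap; exists x.
  (* Without defective points the forward partner of [x] is also its backward partner. *)
  have [w [fxw fVxw]] := contrapT (nd x).
  by rewrite (asymptotic_fun fxz fxw).
have [B fB] := pw_rigid (iet_pw f).
have /choice[N NP] z : exists n0, forall n, (n0 <= n)%N ->
    val ((f^-1 ^+ n)%g (kappa z)) = val (lmap (f^-1 ^+ n)%g z) by exact: (kP z).2.
have [e0 _] := @unit_ocP R 1 ltr01 (lexx 1).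
pose c b := insubd e0 b.
(* Besides 1, [D] collects the finitely many places on backward orbits of the left germs at breaks
   before the backward gluing takes effect. *)
pose D := 1 :: flatten [seq [seq val (lmap (f^-1 ^+ n)%g (c b)) | n <- iota 0 (N (c b))]
  | b <- B].
exists kappa, D; split=> //.
  move=> z w zw; have [zP _] := kP z; have [wP _] := kP w.
  by apply: asymptotic_fun zP _; rewrite zw.
move=> z; rewrite inE negb_or => /andP[z1 zD].
have /andP[z0 zle1] := valP z.
have zlt1 : val z < 1 by rewrite lt_def eq_sym z1.
have [x xE] := unit_coP (ltW z0) zlt1.
(* If the forward orbit of [x] meets no break, [x] and [z] stay together. Otherwise the backward
   gluing is applied at the first break, met at time [n]. *)
have [[n nB]|nb] := pselect (exists n, val ((f ^+ n)%g x) \in B); last first.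
  suff -> : kappa z = x by [].
  apply: asymptotic_inj (kP z).1 _; apply: (asymptotic_glued fB) => // n.
  by apply/negP => nB; apply: nb; exists n.
have {n nB} [n nB nmin] : exists2 n, val ((f ^+ n)%g x) \in B &
    forall k, (k < n)%N -> val ((f ^+ k)%g x) \notin B.
  have exB : exists n, val ((f ^+ n)%g x) \in B by exists n.
  exists (ex_minn exB); first by case: ex_minnP.
  move=> k; case: ex_minnP => m _ mmin; rewrite ltnNge; apply: contraNN; exact: mmin.
pose w := lmap (f ^+ n)%g z.
have wE : val w = val ((f ^+ n)%g x).
  by rewrite /w -(iterates_glued fB xE).
have cw : c (val w) = w by rewrite /c valKd.
have zw : lmap (f^-1 ^+ n)%g w = z by rewrite /w expVgn lmapK.
have kw : (f^-1 ^+ n)%g (kappa w) = kappa z.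
  apply: asymptotic_inj (kP z).1; rewrite -zw.
  apply: asymptotic_equivariant (kP w).1 => //.
  exact/esym/(commuteX n)/commuteV.
(* From time [N w] on, the backward gluing puts [kappa z] at the place of [z]; otherwise [z] is
   listed in [D]. *)
have [lt|le] := ltnP n (N w); last by rewrite -kw NP // zw.
case/negP: zD; apply/flattenP; exists [seq val (lmap (f^-1 ^+ k)%g (c (val w))) |
    k <- iota 0 (N (c (val w)))].
  by apply/mapP; exists (val w) => //; rewrite wE.
by rewrite cw; apply/mapP; exists n; rewrite ?mem_iota ?zw.
Qed.

End Asymptotics.

(** * The rotation flow of a gluing *)

Section Flow.
Variable R : realType.
Implicit Types (f g : iet R) (x y : unit_co R) (z w : unit_oc R) (B : seq R).

(** Applied to the [kappa]-images of special points and to the special points, it yields the time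
    scale [d] of the flow. *)
Lemma gap_bound (L1 L2 : seq R) : exists d, 0 < d /\
  forall a b, a \in L1 -> b \in L2 -> a < b -> a + d < b.
Proof.
have one a : exists d, 0 < d /\ forall b, b \in L2 -> a < b -> a + d < b.
  elim: L2 => [|c L2 [d [d0 dP]]]; first by exists 1.
  have [ac|ca] := ltP a c; last first.
    exists d; split=> // b; rewrite inE => /predU1P[->|/dP//].
    by rewrite ltNge ca.
  exists (Num.min d ((c - a) / 2)); split.
    by rewrite lt_min d0 divr_gt0 // subr_gt0.
  move=> b; rewrite inE => /predU1P[->|bL] ab.
    have : Num.min d ((c - a) / 2) <= (c - a) / 2 by rewrite ge_min lexx orbT.
    lra.
  have : Num.min d ((c - a) / 2) <= d by rewrite ge_min lexx.
  by have := dP b bL ab; lra.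
elim: L1 => [|a L1 [d [d0 dP]]]; first by exists 1.
have [e [e0 eP]] := one a; exists (Num.min d e); split; first by rewrite lt_min d0.
have de : Num.min d e <= d by rewrite ge_min lexx.
have ee : Num.min d e <= e by rewrite ge_min lexx orbT.
move=> a' b; rewrite inE => /predU1P[->|aL] bL ab.
  by have := eP b bL ab; lra.
by have := dP a' b aL bL ab; lra.
Qed.

Lemma last_break B x : exists r, [/\ r \in 0 :: B, 0 <= r, r <= val x &
  forall b, b \in B -> r < b -> val x < b].
Proof.
have /andP[x0 _] := valP x.
elim: B => [|c B [r [rB r0 rx rP]]]; first by exists 0; rewrite inE eqxx.
have rB' : r \in [:: 0, c & B].
  by move: rB; rewrite !inE => /orP[->//|->]; rewrite !orbT.
have [xc|cx] := ltP (val x) c.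
  exists r; split=> // b; rewrite inE => /predU1P[->//|]; exact: rP.
have [rc|cr] := ltP r c.
  exists c; split=> //; first by rewrite !inE eqxx orbT.
    exact: ltW (le_lt_trans r0 rc).
  move=> b; rewrite inE => /predU1P[->|bB cb]; first by rewrite ltxx.
  exact: rP (lt_trans rc cb).
exists r; split=> // b; rewrite inE => /predU1P[->|]; last exact: rP.
by rewrite ltNge cr.
Qed.

Variables (kappa : unit_oc R -> unit_co R) (D : seq R).
Hypotheses (kappa_inj : injective kappa)
           (kappaD : forall z, val z \notin D -> val (kappa z) = val z).

(* A unit-speed move of duration t: to the right up to [z], where it jumps to
   [kappa z] and goes on to the right; no other jump occurs. *)
Definition flow t x y := exists z, [/\ val x < val z, val z <= val x + t,
  (forall w, val x < val w -> val w < val z -> val (kappa w) = val w),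
  val y = val (kappa z) + (val x + t - val z) &
  forall w, val (kappa z) < val w -> val w <= val y -> val (kappa w) = val w].

(** The witness [z] is not unique: any place crossed without a jump may serve. At two distinct
    witnesses [kappa] does not jump, and both moves are the translation by [t]. *)
Lemma flow_fun t x y y' : flow t x y -> flow t x y' -> y = y'.
Proof.
have half z z' : val z < val z' -> forall y y',
    [/\ val x < val z, val z <= val x + t,
      (forall w, val x < val w -> val w < val z -> val (kappa w) = val w),
      val y = val (kappa z) + (val x + t - val z) &
      forall w, val (kappa z) < val w -> val w <= val y -> val (kappa w) = val w] ->
    [/\ val x < val z', val z' <= val x + t,
      (forall w, val x < val w -> val w < val z' -> val (kappa w) = val w) &
      val y' = val (kappa z') + (val x + t - val z')] -> y = y'.
  move=> zz' {}y {}y' [xz zt _ yE yP] [xz' z't zP' yE'].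
  have kz := zP' z xz zz'.
  have kz' : val (kappa z') = val z'.
    by apply: yP; rewrite ?yE kz //; lra.
  by apply: val_inj; rewrite yE yE' kz kz'; lra.
move=> [z zP] [z' zP'].
have [lt|gt|/val_inj zz'] := ltgtP (val z) (val z').
- by case: zP' => ? ? ? ? _; exact: half lt _ _ zP _.
- by case: zP => ? ? ? ? _; symmetry; exact: half gt _ _ zP' _.
case: zP zP' => _ _ _ yE _ [_ _ _ yE' _].
by apply: val_inj; rewrite yE yE' zz'.
Qed.

(** If [kappa z < kappa z'], the stretch after [kappa z] contains [kappa z'], so injectivity makes
    the second jump trivial; then the stretch before [z'] contains [kappa z], and the first is
    trivial too. *)
Lemma flow_inj t x x' y : flow t x y -> flow t x' y -> x = x'.
Proof.
have half z z' : val (kappa z) < val (kappa z') -> forall x x',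
    [/\ val x < val z, val z <= val x + t,
      val y = val (kappa z) + (val x + t - val z) &
      forall w, val (kappa z) < val w -> val w <= val y -> val (kappa w) = val w] ->
    [/\ val x' < val z', val z' <= val x' + t,
      (forall w, val x' < val w -> val w < val z' -> val (kappa w) = val w) &
      val y = val (kappa z') + (val x' + t - val z')] -> x = x'.
  move=> zz' {}x {}x' [xz zt yE yP] [xz' z't zP' yE'].
  have /andP[k0 _] := valP (kappa z); have /andP[_ k1] := valP (kappa z').
  have /andP[x'0 _] := valP x'.
  have [w wE] := unit_ocP (le_lt_trans k0 zz') (ltW k1).
  have kw : val (kappa w) = val w by apply: yP; rewrite wE // yE'; lra.
  have wz' : w = z' by apply/kappa_inj/val_inj; rewrite kw.
  rewrite wz' in wE.
  have x'k : val x' < val (kappa z) by lra.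
  have [m mE] := unit_ocP (le_lt_trans x'0 x'k) (ltW (lt_trans zz' k1)).
  have km : val (kappa m) = val m by apply: zP'; rewrite mE // wE.
  have mz : m = z by apply/kappa_inj/val_inj; rewrite km.
  by rewrite mz in mE; apply: val_inj; lra.
move=> [z [xz zt zP yE yP]] [z' [xz' zt' zP' yE' yP']].
have [lt|gt|/val_inj/kappa_inj zz'] := ltgtP (val (kappa z)) (val (kappa z')).
- by apply: (half _ _ lt).
- by symmetry; apply: (half _ _ gt).
by apply: val_inj; move: yE yE'; rewrite zz'; lra.
Qed.

Lemma flow_unjumped t x y : 0 < t -> val y = val x + t ->
    (forall w, val x < val w -> val w <= val y -> val (kappa w) = val w) ->
  flow t x y.
Proof.
move=> t0 yE free; have /andP[x0 _] := valP x; have /andP[_ y1] := valP y.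
have xy : val x < val y by rewrite yE ltrDl.
have [z zE] := unit_ocP (le_lt_trans x0 xy) (ltW y1).
have kz : val (kappa z) = val z by apply: free; rewrite zE.
exists z; rewrite kz zE; split => //; first by rewrite yE.
- by move=> w xw /ltW; exact: free.
- by rewrite -yE addrC subrK.
- by move=> w yw wy; move: (lt_le_trans yw wy); rewrite ltxx.
Qed.

Lemma run_flow (J : Type) (T : J -> unit_co R -> unit_co R) j t n p x : 0 < t ->
    (forall y y', flow t y y' -> T j y = y') ->
    (forall w, val p < val w -> val w <= val x -> val (kappa w) = val w) ->
    val p + n%:R * t <= val x ->
  val (run T (nseq n j) p) = val p + n%:R * t.
Proof.
move=> t0 TE free; have /andP[p0 _] := valP p; have /andP[_ x1] := valP x.
elim: n => [|n IHn]; first by rewrite mul0r addr0.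
rewrite -natr1 mulrDl mul1r addrA => nx.
have nx' : val p + n%:R * t < val x by apply: lt_le_trans nx; rewrite ltrDl.
have {}IHn := IHn (ltW nx').
have pn : val p <= val p + n%:R * t by rewrite lerDl mulr_ge0 // ltW.
have y0 : 0 <= val p + n%:R * t + t.
  exact: addr_ge0 (le_trans p0 pn) (ltW t0).
have [y yE] := unit_coP y0 (le_lt_trans nx x1).
rewrite -yE; congr val; apply: TE; apply: flow_unjumped; rewrite // ?IHn //.
by move=> w xw wy; apply: free; [exact: le_lt_trans xw|rewrite (le_trans wy) // yE].
Qed.

Variable Sp : seq R.
Hypotheses (Sp1 : 1 \in Sp) (D_Sp : {subset D <= Sp}).

Lemma kappa_id z : val z \notin Sp -> val (kappa z) = val z.
Proof. by move=> zS; apply: kappaD; apply: contraNN zS => /D_Sp. Qed.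

(** A move whose two stretches are free of special points, so that a map with breaks in [Sp] is a
    translation on each. *)
Definition special_flow t x z y := [/\ val x < val z, val z <= val x + t,
  (forall b, b \in Sp -> val x < b -> val z <= b),
  val y = val (kappa z) + (val x + t - val z) &
  forall b, b \in Sp -> val (kappa z) < b -> val y < b].

Lemma special_flow_flow t x z y : special_flow t x z y -> flow t x y.
Proof.
case=> xz zt zS yE yS; exists z; split=> // w.
  move=> xw wz; apply: kappa_id; apply/negP => /zS/(_ xw).
  by rewrite leNgt wz.
move=> kw wy; apply: kappa_id; apply/negP => /yS/(_ kw).
by rewrite ltNge wy.
Qed.

Variable d : R.
(** For the duration [d] after a jump at a special point, no special point is met. *)
Hypothesis d_gap : forall z b,
  val z \in Sp -> b \in Sp -> val (kappa z) < b -> val (kappa z) + d < b.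

Lemma special_flow_ex t x : 0 < t -> t <= d -> exists z y, special_flow t x z y.
Proof.
move=> t0 td; have /andP[x0 x1] := valP x.
have [e [xe e1 eS eP]] := next_break Sp x1.
have {}eS : e \in Sp by case: eS => // ->.
(* [z] is the next special point if it is reached in time, else the endpoint [val x + t], where
   [kappa] does not jump. *)
have [et|te] := leP e (val x + t).
  have [z zE] := unit_ocP (le_lt_trans x0 xe) e1.
  have /andP[k0 k1] := valP (kappa z).
  have lt b : b \in Sp -> val (kappa z) < b ->
      val (kappa z) + (val x + t - val z) < b.
    by move=> bS kb; have := d_gap (z := z) _ bS kb; rewrite zE => /(_ eS); lra.
  have y0 : 0 <= val (kappa z) + (val x + t - val z) by rewrite zE; lra.
  have [y yE] := unit_coP y0 (lt 1 Sp1 k1).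
  by exists z, y; split; rewrite ?zE ?yE //; rewrite -zE.
have xt : val x < val x + t by lra.
have [z zE] := unit_ocP (le_lt_trans x0 xt) (ltW (lt_le_trans te e1)).
have kz : val (kappa z) = val z.
  by apply: kappa_id; rewrite zE; apply/negP => zS; have := eP _ zS xt; rewrite leNgt te.
exists z, (kappa z); split; rewrite ?zE ?kz //.
- by move=> b bS xb; rewrite (le_trans (ltW te)) // eP.
- by rewrite zE; lra.
Qed.

(** The gap [d] excludes two special jumps within the time [s + t]; one witness is thus trivial, and
    the other serves for the composite move. *)
Lemma flowD s t x y y' : 0 < s -> 0 < t -> s + t <= d ->
  flow s x y -> flow t y y' -> flow (s + t) x y'.
Proof.
move=> s0 t0 std fxy fyy'.
have [|z1 [y1 S1]] := special_flow_ex x s0; first by lra.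
have yE := flow_fun fxy (special_flow_flow S1); rewrite -{y1}yE in S1.
have [|z2 [y2 S2]] := special_flow_ex y t0; first by lra.
have yE := flow_fun fyy' (special_flow_flow S2); rewrite -{y2}yE in S2.
case: S1 S2 => [xz1 z1t z1S yE yS] [yz2 z2t z2S yE' yS'].
have id1 w : val x < val w -> val w < val z1 -> val (kappa w) = val w.
  move=> xw wz; apply: kappa_id; apply/negP => /z1S/(_ xw).
  by rewrite leNgt wz.
have idy w : val (kappa z1) < val w -> val w <= val y -> val (kappa w) = val w.
  by move=> kw wy; apply: kappa_id; apply/negP => /yS/(_ kw); rewrite ltNge wy.
have id2 w : val y < val w -> val w < val z2 -> val (kappa w) = val w.
  by move=> yw wz; apply: kappa_id; apply/negP => /z2S/(_ yw); rewrite leNgt wz.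
have idy' w : val (kappa z2) < val w -> val w <= val y' -> val (kappa w) = val w.
  by move=> kw wy; apply: kappa_id; apply/negP => /yS'/(_ kw); rewrite ltNge wy.
have [z1Sp|z1N] := boolP (val z1 \in Sp); last first.
  have kz1 := kappa_id z1N; rewrite kz1 in yE idy.
  exists z2; split=> //; [lra|lra| |by rewrite yE'; lra].
  move=> w xw wz2; have [lt|gt|/val_inj ->//] := ltgtP (val w) (val z1).
    exact: id1.
  by have [wy|yw] := leP (val w) (val y); [exact: idy|exact: id2].
have [z2Sp|z2N] := boolP (val z2 \in Sp).
  have := d_gap z1Sp z2Sp; lra.
have kz2 := kappa_id z2N; rewrite kz2 in yE' idy'.
exists z1; split=> //; [lra|by rewrite yE'; lra|].
move=> w kw wy'; have [wy|yw] := leP (val w) (val y); first exact: idy.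
have [lt|gt|/val_inj ->//] := ltgtP (val w) (val z2); first exact: id2.
exact: idy'.
Qed.

Lemma flow_equivariant g B t x z y : rigid g B -> {subset B <= Sp} ->
    (forall w, kappa (lmap g w) = g (kappa w)) ->
  special_flow t x z y -> flow t (g x) (g y).
Proof.
move=> gB BS kg [xz zt zS yE yS].
have /andP[x0 x1] := valP x; have /andP[_ z1] := valP z; have /andP[y0 y1] := valP y.
have /andP[k0 k1] := valP (kappa z).
have gz : val (lmap g z) = val (g x) + (val z - val x).
  by apply: (lmap_rigid gB xz) => b bB xb; apply: zS => //; exact: BS.
have ky : val (kappa z) <= val y by rewrite yE; lra.
have gy : val (g y) = val (g (kappa z)) + (val y - val (kappa z)).
  by apply: (gB (kappa z) y ky) => b bB kb; apply: yS => //; exact: BS.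
exists (lmap g z); rewrite kg; split; rewrite ?gz; [lra|lra| |by rewrite gy yE; lra|].
  move=> w' xw wz'.
  (* The place [w'] is the image of a left germ [w] and of a point [p] at one position; since
     [kappa w = p], equivariance shows that [kappa] does not jump at [w']. *)
  have xr : val x < val x + (val w' - val (g x)) by lra.
  have rz : val x + (val w' - val (g x)) < val z by lra.
  have [w wE] := unit_ocP (le_lt_trans x0 xr) (ltW (lt_le_trans rz z1)).
  have [p pE] := unit_coP (ltW (le_lt_trans x0 xr)) (lt_le_trans rz z1).
  have gw : val (lmap g w) = val w'.
    rewrite (lmap_rigid gB (x := x)) ?wE //; first by lra.
    by move=> b bB xb; exact/ltW/(lt_le_trans rz)/zS/xb/BS.
  have gp : val (g p) = val w'.
    rewrite (gB x p) ?pE ?(ltW xr) //; first by lra.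
    by move=> b bB xb; exact/(lt_le_trans rz)/zS/xb/BS.
  have <- : lmap g w = w' by apply: val_inj.
  rewrite kg gw -gp; congr (val (g _)); apply: val_inj.
  rewrite pE kappa_id ?wE //; apply/negP => wS.
  by have := zS _ wS xr; rewrite leNgt rz.
move=> w' kw wy'.
have kr : val (kappa z) < val (kappa z) + (val w' - val (g (kappa z))) by lra.
have ry : val (kappa z) + (val w' - val (g (kappa z))) <= val y by lra.
have [w wE] := unit_ocP (le_lt_trans k0 kr) (ltW (le_lt_trans ry y1)).
have [p pE] := unit_coP (ltW (le_lt_trans k0 kr)) (le_lt_trans ry y1).
have gw : val (lmap g w) = val w'.
  rewrite (lmap_rigid gB (x := kappa z)) ?wE //; first by lra.
  by move=> b bB xb; exact/ltW/(le_lt_trans ry)/yS/xb/BS.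
have gp : val (g p) = val w'.
  rewrite (gB (kappa z) p) ?pE ?(ltW kr) //; first by lra.
  by move=> b bB xb; exact/(le_lt_trans ry)/yS/xb/BS.
have <- : lmap g w = w' by apply: val_inj.
rewrite kg gw -gp; congr (val (g _)); apply: val_inj.
rewrite pE kappa_id ?wE //; apply/negP => wS.
by have := yS _ wS kr; rewrite ltNge ry.
Qed.

End Flow.

(** * Commuting powers of maps compatible with a gluing *)

Section GluedPowers.
Variable R : realType.
Implicit Types (g h : iet R) (x y : unit_co R) (z w : unit_oc R).
Variables (kappa : unit_oc R -> unit_co R) (D : seq R).
Hypotheses (kappa_inj : injective kappa)
           (kappaD : forall z, val z \notin D -> val (kappa z) = val z).

(** The flow maps of short duration are injective, commute with each other and with [g] and [h], and
    link every point to one of finitely many, so [powers_commute] applies. *)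
Lemma glued_powers_commute g h :
    (forall z, kappa (lmap g z) = g (kappa z)) ->
    (forall z, kappa (lmap h z) = h (kappa z)) ->
  exists2 N, (0 < N)%N & forall x, iter N g (iter N h x) = iter N h (iter N g x).
Proof.
move=> kg kh; have [Bg gB] := pw_rigid (iet_pw g); have [Bh hB] := pw_rigid (iet_pw h).
pose Sp := 1 :: D ++ Bg ++ Bh.
have Sp1 : 1 \in Sp by rewrite inE eqxx.
have D_Sp : {subset D <= Sp} by move=> b bD; rewrite inE mem_cat bD orbT.
have Bg_Sp : {subset Bg <= Sp} by move=> b bB; rewrite inE !mem_cat bB !orbT.
have Bh_Sp : {subset Bh <= Sp} by move=> b bB; rewrite inE !mem_cat bB !orbT.
have [e1 _] := @unit_ocP R 1 ltr01 (lexx 1).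
have [e0 _] := @unit_coP R 0 (lexx 0) ltr01.
have [d [d0 dP]] := gap_bound [seq val (kappa (insubd e1 b)) | b <- Sp] Sp.
have d_gap z b : val z \in Sp -> b \in Sp -> val (kappa z) < b ->
    val (kappa z) + d < b.
  move=> zS bS; apply: dP => //; apply/mapP; exists (val z) => //.
  by rewrite valKd.
(* Half of [d], so that two successive moves satisfy the bound in [flowD]. *)
pose J := {t : R | 0 < t <= d / 2}.
have sflow (j : J) x : exists z y, special_flow kappa Sp (val j) x z y.
  by have /andP[j0 jd] := valP j; apply: (special_flow_ex kappaD Sp1 D_Sp d_gap) => //; lra.
have /choice[T' TP] (jx : J * unit_co R) : exists y, flow kappa (val jx.1) jx.2 y.
  have [z [y S]] := sflow jx.1 jx.2; exists y.
  exact: (special_flow_flow kappaD D_Sp S).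
pose T j x := T' (j, x).
have TE j x y : flow kappa (val j) x y -> T j x = y.
  by move=> fxy; exact: flow_fun (TP (j, x)) fxy.
have T_comm i j x : T i (T j x) = T j (T i x).
  have /andP[i0 id] := valP i; have /andP[j0 jd] := valP j.
  apply: (@flow_fun _ kappa (val j + val i) x).
    by apply: (flowD kappaD Sp1 D_Sp d_gap j0 i0 _ (TP (j, x)) (TP (i, T j x))); lra.
  rewrite addrC.
  by apply: (flowD kappaD Sp1 D_Sp d_gap i0 j0 _ (TP (i, x)) (TP (j, T i x))); lra.
have T_inj i : injective (T i).
  move=> x x' xx'; apply: (flow_inj kappa_inj (TP (i, x))).
  by rewrite [T' _]xx'; exact: (TP (i, x')).
have equi (f : iet R) B : rigid f B -> {subset B <= Sp} -> (forall z, kappa (lmap f z) = f (kappa z)) ->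
    forall j x, f (T j x) = T j (f x).
  move=> fB BS kf j x; have [z [y S]] := sflow j x.
  rewrite (TE _ _ _ (special_flow_flow kappaD D_Sp S)); symmetry; apply: TE.
  exact: (flow_equivariant kappaD D_Sp fB BS kf S).
(* Entries outside [[0, 1)], such as 1, fall back on the default [e0]. *)
pose reps (i : 'I_(size (0 :: Sp))) := insubd e0 (0 :: Sp)`_i.
exists (size (0 :: Sp))`!; first exact: fact_gt0.
move=> x; apply: (@powers_commute _ _ T T_comm T_inj (fun=> True) _ reps g h) => //.
- exact: equi gB Bg_Sp kg.
- exact: iet_inj.
- exact: equi hB Bh_Sp kh.
- exact: iet_inj.
move=> {}x _; have [r [rS r0 rx rP]] := last_break Sp x.
have /andP[x0 x1] := valP x.
have [p pE] := unit_coP r0 (le_lt_trans rx x1).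
have /(nthP 0)[i ilt iE] := rS; exists (Ordinal ilt).
have -> : reps (Ordinal ilt) = p by rewrite /reps /= iE -pE valKd.
have [rxE|xr] := eqVneq r (val x).
  by exists [::], [::]; apply: val_inj; rewrite /= -rxE.
have {xr}rx : r < val x by rewrite lt_def eq_sym xr.
(* [n] equal moves, each of duration at most [d / 2], lead from [p] to [x]. *)
pose n := Num.bound ((val x - r) / (d / 2)).
have xrd : 0 < (val x - r) / (d / 2) by apply: divr_gt0; lra.
have nR : (val x - r) / (d / 2) < n%:R by apply: archi_boundP; exact: ltW.
have n0 : 0 < n%:R :> R by exact: lt_trans nR.
have tP : 0 < (val x - r) / n%:R <= d / 2.
  rewrite divr_gt0 ?subr_gt0 //= ler_pdivrMr // mulrC -ler_pdivrMr; last by lra.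
  exact: ltW.
pose j : J := exist _ ((val x - r) / n%:R) tP.
have jn : n%:R * val j = val x - r by rewrite /= mulrC divfK ?lt0r_neq0.
have /andP[j0 _] := valP j.
have rx' : val p + n%:R * val j <= val x by rewrite jn pE addrC subrK.
have free w : val p < val w -> val w <= val x -> val (kappa w) = val w.
  rewrite pE => rw wx; apply: kappaD; apply/negP => /D_Sp/rP/(_ rw).
  by rewrite ltNge wx.
exists [::], (nseq n j); apply: val_inj.
by rewrite (run_flow j0 (TE j) free rx') jn pE /= addrC subrK.
Qed.

End GluedPowers.

(** * The group C2 *)

Section Density.
Variables (R : realType) (G : groupType) (rho : {multiplicative G -> iet R}).

(** From [x] up to the next break [e] both maps are translations; one orbit point between [x] and
    [e] where they agree forces [f x = g x]. *)
Lemma minimal_eq (f g : iet R) (x0 : unit_co R) : minimal_action rho ->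
  (forall a, f (rho a x0) = g (rho a x0)) -> f = g.
Proof.
move=> rho_min fg; apply: iet_eq => x; apply: val_inj.
have [Bf fB] := pw_rigid (iet_pw f); have [Bg gB] := pw_rigid (iet_pw g).
have /andP[x_ge0 x1] := valP x.
have [e [xe e1 _ eP]] := next_break (Bf ++ Bg) x1.
have t01 : (`[0%R, 1%R[ : set R)%classic ((val x + e) / 2).
  have t0 : 0 <= (val x + e) / 2 by lra.
  have t1 : (val x + e) / 2 < 1 by lra.
  by rewrite /mkset in_itv; apply/andP.
have r0 : 0 < (e - val x) / 2 by lra.
have [_ [[a _ <-]]] := rho_min x0 _ t01 _ (nbhsx_ballx _ _ r0).
set y := rho a x0; move=> ay; have fgy : val (f y) = val (g y) by rewrite fg.
have /andP[ay1 ay2] : - ((e - val x) / 2) < (val x + e) / 2 - val y < (e - val x) / 2.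
  by rewrite -ltr_norml; exact: ay.
have xy : val x <= val y by lra.
have ye : val y < e by lra.
have nb b : b \in Bf ++ Bg -> val x < b -> val y < b.
  by move=> bB xb; exact: lt_le_trans ye (eP b bB xb).
rewrite (fB x y xy) in fgy; last by move=> b bB; apply: nb; rewrite mem_cat bB.
rewrite (gB x y xy) in fgy; last by move=> b bB; apply: nb; rewrite mem_cat bB orbT.
lra.
Qed.

(** As the group generated by [q] is normal, a power of [q] that fixes [x] fixes its whole orbit; by
    density and faithfulness it is trivial. *)
Lemma normalized_aperiodic (q : G) :
    (forall x, (x * q = q * x)%g \/ (x * q = q^-1 * x)%g) ->
    (forall n, (q ^+ n.+1)%g <> 1%g) ->
  faithful_action rho -> minimal_action rho -> aperiodic (rho q).
Proof.
move=> qJ q_inf rho_inj rho_min n x qx; apply: (q_inf n); apply: rho_inj.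
rewrite gmulf_expg gmulf_one; apply: (minimal_eq (x0 := x) rho_min) => a.
have conj s : (a * q = s * a)%g -> (rho s ^+ n.+1)%g (rho a x) = rho a x.
  move=> /(zpow_conj n.+1)/(congr1 rho)/=; rewrite !gmulfM !gmulf_expg.
  by move=> /(congr1 (fun f : iet R => f x)); rewrite !iet_mulE qx.
case: (qJ a) => [/conj->//|/conj]; rewrite gmulf_inv expVgn => E.
by rewrite -{1}E iet_Kinv.
Qed.

Lemma iter_iet n (f : iet R) x : iter n f x = (f ^+ n)%g x.
Proof. by elim: n => //= n ->; rewrite expgS. Qed.

(* If f has defective points, they form finitely many f-orbits, which the
   centralizer of f permutes; otherwise the gluing turns the action of this
   centralizer into one by isometries of finitely many circles. *)
Lemma centralizer_powers_commute (q a c : G) :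
    (forall x, (x * q = q * x)%g \/ (x * q = q^-1 * x)%g) ->
    (a * q = q * a)%g -> (c * q = q * c)%g ->
    aperiodic (rho q) -> faithful_action rho -> minimal_action rho ->
  exists2 N, (0 < N)%N & (a ^+ N * c ^+ N = c ^+ N * a ^+ N)%g.
Proof.
move=> qJ aq cq ap rho_inj rho_min.
have fJ x : (rho x * rho q = rho q * rho x)%g \/ (rho x * rho q = (rho q)^-1 * rho x)%g.
  by rewrite -gmulf_inv -!gmulfM; case: (qJ x) => ->; [left|right].
have [e0 _] := @unit_coP R 0 (lexx 0) ltr01.
suff [N N0 [x0 NP]] : exists2 N, (0 < N)%N & exists x0, forall g, let y := rho g x0 in
    iter N (rho a) (iter N (rho c) y) = iter N (rho c) (iter N (rho a) y).
  exists N => //; apply: rho_inj; rewrite !gmulfM !gmulf_expg.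
  by apply: (minimal_eq (x0 := x0) rho_min) => g; rewrite !iet_mulE -!iter_iet NP.
have [[x0 x0bad]|nd] := pselect (exists x, defective (rho q) x).
  have [k [reps repsP]] := defective_orbits ap.
  (* In the defective case the commutative monoid is generated by [rho q] alone, indexed by
     [unit]. *)
  have runE n x : run (fun=> rho q) (nseq n tt) x = (rho q ^+ n)%g x.
    by elim: n => //= n ->; rewrite expgS.
  have comm s : (s * q = q * s)%g -> forall x, rho s (rho q x) = rho q (rho s x).
    by move=> sq x; rewrite -!iet_mulE -!gmulfM sq.
  exists k`!; first exact: fact_gt0.
  exists x0 => g y; apply: (@powers_commute _ unit (fun=> rho q) _ _
      (defective (rho q)) k reps).
  - by [].
  - by move=> _; exact: iet_inj.
  - by move=> _; exact: comm.
  - exact: iet_inj.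
  - by move=> _; exact: comm.
  - exact: iet_inj.
  - by move=> z; exact: defective_equivariant.
  - by move=> z; exact: defective_equivariant.
  - move=> z /repsP[n [i nz]]; exists i; case: nz => nz.
      by exists (nseq n tt), [::]; rewrite runE.
    by exists [::], (nseq n tt); rewrite runE.
  - exact: defective_equivariant.
have [kappa [D [kP k_inj kD]]] := asymptotic_gluing ap ((forallNP _).2 nd).
(* Both sides are forward partners of [lmap (rho s) z], and that partner is unique. *)
have kE s z : kappa (lmap (rho s) z) = rho s (kappa z).
  have [k1 _] := kP (lmap (rho s) z).
  have [k2 _] := biasymptotic_equivariant ap (fJ s) (kP z).
  exact: asymptotic_inj k1 k2.
have [N N0 NP] := glued_powers_commute k_inj kD (kE a) (kE c).
by exists N => //; exists e0 => g y.
Qed.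

End Density.

(** * Relations in [C2] and two actions that separate its elements *)

Section C2Models.
Local Notation a := (pres_class _ (wgen (@Ordinal 3 0 isT)) : C2).
Local Notation b := (pres_class _ (wgen (@Ordinal 3 1 isT)) : C2).
Local Notation c := (pres_class _ (wgen (@Ordinal 3 2 isT)) : C2).

Lemma C2_rel_ab : (a * b = b^-1 * a)%g.
Proof.
have : pres_class _ (wgen (@Ordinal 3 0 isT) ++ wgen (@Ordinal 3 1 isT) ++
    winv (wgen (@Ordinal 3 0 isT))) = pres_class _ (winv (wgen (@Ordinal 3 1 isT))) :> C2.
  by apply: pres_class_rel; rewrite !inE eqxx.
rewrite !(pres_class_cat, pres_class_winv) => <-.
by rewrite -!mulgA mulVg mulg1.
Qed.

Lemma C2_rel_bc : (b * c = c^-1 * b)%g.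
Proof.
have : pres_class _ (wgen (@Ordinal 3 1 isT) ++ wgen (@Ordinal 3 2 isT) ++
    winv (wgen (@Ordinal 3 1 isT))) = pres_class _ (winv (wgen (@Ordinal 3 2 isT))) :> C2.
  by apply: pres_class_rel; rewrite !inE eqxx orbT.
rewrite !(pres_class_cat, pres_class_winv) => <-.
by rewrite -!mulgA mulVg mulg1.
Qed.

Lemma C2_a_bb : (a * (b * b) = (b * b)^-1 * a)%g.
Proof. by rewrite mulgA C2_rel_ab -mulgA C2_rel_ab mulgA -invgM. Qed.

Lemma C2_aa_bb : (a * a * (b * b) = b * b * (a * a))%g.
Proof. by rewrite -mulgA C2_a_bb mulgA (conj_invr C2_a_bb) -mulgA. Qed.

Lemma C2_c_bb : (c * (b * b) = b * b * c)%g.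
Proof. by symmetry; rewrite -mulgA C2_rel_bc mulgA (conj_invr C2_rel_bc) -mulgA. Qed.

Lemma C2_bb_normal (x : C2) :
  (x * (b * b) = b * b * x)%g \/ (x * (b * b) = (b * b)^-1 * x)%g.
Proof.
have normM (q y z : C2) : (y * q = q * y)%g \/ (y * q = q^-1 * y)%g ->
    (z * q = q * z)%g \/ (z * q = q^-1 * z)%g ->
    (y * z * q = q * (y * z))%g \/ (y * z * q = q^-1 * (y * z))%g.
  move=> yq [zq|zq]; rewrite -mulgA zq !mulgA; first by case: yq => ->; [left|right].
  case: yq => yq; [right|left]; last by rewrite (conj_invr yq).
  by rewrite (commuteV yq).
have normV (q y : C2) : (y * q = q * y)%g \/ (y * q = q^-1 * y)%g ->
    (y^-1 * q = q * y^-1)%g \/ (y^-1 * q = q^-1 * y^-1)%g.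
  case=> yq; [left|right]; apply: (mulgI y); rewrite mulVKg mulgA.
    by rewrite yq mulgK.
  by rewrite (conj_invr yq) mulgK.
pose q := (b * b)%g.
have normG i : let y := pres_class _ (wgen i) : C2 in
    (y * q = q * y)%g \/ (y * q = q^-1 * y)%g.
  case: i => [[|[|[|//]]] lt_i]; rewrite (bool_irrelevance lt_i isT) /=.
  - by right; exact: C2_a_bb.
  - by left; rewrite /q mulgA.
  - by left; exact: C2_c_bb.
elim/presented_ind: x => [|i x xq|i x xq].
- by left; rewrite mul1g mulg1.
- exact: normM (normG i) xq.
- exact: normM (normV _ _ (normG i)) xq.
Qed.

(** In the action on the integers by [a : x -> -x], [b : x -> x + 1] and trivial [c], [b^2]
    translates by 2. *)
Lemma C2_bb_inf n : ((b * b) ^+ n.+1)%g <> 1%g.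
Proof.
pose act (l : 'I_3 * bool) (x : int) : int :=
  match val l.1 with 0%N => - x | 1%N => if l.2 then x - 1 else x + 1 | _ => x end.
have [||A [AE AM]] := @presented_act 3 [:: (wgen (@Ordinal 3 0 isT) ++
    wgen (@Ordinal 3 1 isT) ++ winv (wgen (@Ordinal 3 0 isT)),
    winv (wgen (@Ordinal 3 1 isT))); (wgen (@Ordinal 3 1 isT) ++
    wgen (@Ordinal 3 2 isT) ++ winv (wgen (@Ordinal 3 1 isT)),
    winv (wgen (@Ordinal 3 2 isT)))] _ act.
- by move=> [[[|[|[|//]]] lt_i] []] x; rewrite /act /=; lia.
- by move=> r; rewrite !inE => /orP[] /eqP -> x; rewrite /act /=; lia.
have A1 t : A 1%g t = t by exact: (AE [::]).
have AX x n' t : A (x ^+ n')%g t = iter n' (A x) t.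
  by elim: n' => [|m IHm]; rewrite ?expg0 ?A1 // expgS AM IHm.
move=> /(congr1 (fun x => A x 0)); rewrite AX A1.
suff -> : forall m, iter m (A (b * b)%g) 0 = Posz m.*2 by [].
elim=> [//|m IHm]; rewrite iterS IHm AM !AE /act /=; lia.
Qed.

(** In the affine action on the rationals by [a : x -> 2x], [b : x -> -x], [c : x -> x + 1], the two
    products send 0 to [4^N N] and to [N]. *)
Lemma C2_powers_noncommute N : (0 < N)%N ->
  ((a * a) ^+ N * c ^+ N)%g <> (c ^+ N * (a * a) ^+ N)%g.
Proof.
move=> N0; pose act (l : 'I_3 * bool) (x : rat) : rat :=
  match val l.1 with
  | 0%N => if l.2 then x / 2%:R else 2%:R * x
  | 1%N => - x
  | _ => if l.2 then x - 1 else x + 1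
  end.
have [||A [AE AM]] := @presented_act 3 [:: (wgen (@Ordinal 3 0 isT) ++
    wgen (@Ordinal 3 1 isT) ++ winv (wgen (@Ordinal 3 0 isT)),
    winv (wgen (@Ordinal 3 1 isT))); (wgen (@Ordinal 3 1 isT) ++
    wgen (@Ordinal 3 2 isT) ++ winv (wgen (@Ordinal 3 1 isT)),
    winv (wgen (@Ordinal 3 2 isT)))] _ act.
- by move=> [[[|[|[|//]]] lt_i] []] x; rewrite /act /=; field.
- by move=> r; rewrite !inE => /orP[] /eqP -> x; rewrite /act /=; field.
have A1 t : A 1%g t = t by exact: (AE [::]).
have AX x n t : A (x ^+ n)%g t = iter n (A x) t.
  by elim: n => [|m IHm]; rewrite ?expg0 ?A1 // expgS AM IHm.
move=> /(congr1 (fun x => A x 0)); rewrite !AM !AX.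
have aaE m t : iter m (A (a * a)%g) t = 4%:R ^+ m * t.
  elim: m => [|m IHm]; first by rewrite expr0 mul1r.
  by rewrite iterS IHm AM !AE /act /= exprS; ring.
have cE m t : iter m (A c) t = t + m%:R.
  elim: m => [|m IHm]; first by rewrite addr0.
  by rewrite iterS IHm AE /act /= -natr1 addrA.
rewrite !aaE !cE mulr0 !add0r => E.
have : 4%:R ^+ N = 1 :> rat.
  by apply: (mulIf (x := N%:R)); rewrite ?mul1r // pnatr_eq0 -lt0n.
by move/eqP; rewrite -natrX pnatr_eq1 -[1%N](expn0 4) eqn_exp2l // -leqn0 leqNgt N0.
Qed.

End C2Models.

(** The normal cyclic group is generated by [b^2]. Since [a] inverts [b^2], it is [a^2] that
    centralizes it together with [c]. *)
Lemma C2_no_faithful_minimal (R : realType) (rho : {multiplicative C2 -> iet R}) :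
  faithful_action rho -> minimal_action rho -> False.
Proof.
move=> rho_inj rho_min.
have ap := normalized_aperiodic C2_bb_normal C2_bb_inf rho_inj rho_min.
have [N N0] := centralizer_powers_commute C2_bb_normal C2_aa_bb C2_c_bb
  ap rho_inj rho_min.
exact: C2_powers_noncommute.
Qed.

Theorem theorem7 (R : realType) :
  [/\ exists rho : {multiplicative BS1m1 -> iet R},
        free_action rho /\ minimal_action rho,
      exists rho : {multiplicative C1 -> iet R},
        free_action rho /\ minimal_action rho &
      ~ exists rho : {multiplicative C2 -> iet R},
        faithful_action rho /\ minimal_action rho].
Proof.
split; [exact: BS1m1_free_minimal|exact: C1_free_minimal|].
by case=> rho [rho_inj rho_min]; exact: C2_no_faithful_minimal rho_inj rho_min.
Qed.
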